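(* Let $Q$ be a finite quiver with vertex set $Q_0$. For every dimension vector $\mathbf{d}\in\mathbb{N}Q_0$ with $\mathbf{d}\ne 0$ the following identity holds in $K_0(\mathrm{Var}_{\mathbb C})$: $$[N_{\mathbf d}]=-\sum_{\mathbf{e}\lneqq\mathbf{d}}(-1)^{\dim\mathbf{d}-\dim\mathbf{e}}\cdot\mathbb{L}^{\sum_{i}\left(\binom{d_i}{2}-\binom{e_i}{2}\right)-\langle\mathbf{e},\mathbf{d}-\mathbf{e}\rangle}\cdot\left[{\mathbf{d}\atop\mathbf{e}}\right]_{\mathbb{L}}\cdot[N_{\mathbf e}],$$ where the sum is over all $\mathbf{e}\in\mathbb{N}Q_0$ with $\mathbf{e}\le\mathbf{d}$ componentwise and $\mathbf{e}\ne\mathbf{d}$. In particular, for each $\mathbf{d}\in\mathbb{N}Q_0$ there exists a polynomial $n_{\mathbf d}(x)\in\mathbb{Z}[x]$ such that $[N_{\mathbf d}]=n_{\mathbf d}(\mathbb{L})$.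
   Context: $\mathbb{N}$ includes $0$. Arrows of $Q$ are written $\alpha:i\to j$. The Euler form is $\langle\mathbf{d},\mathbf{e}\rangle=\sum_{i\in Q_0}d_ie_i-\sum_{\alpha:i\to j}d_ie_j$. For $\mathbf{d}\in\mathbb{N}Q_0$ fix complex vector spaces $V_i$ with $\dim V_i=d_i$; $R_{\mathbf d}=\bigoplus_{\alpha:i\to j}\mathrm{Hom}_{\mathbb C}(V_i,V_j)$, with the base change action of $G_{\mathbf d}=\prod_{i\in Q_0}\mathrm{GL}(V_i)$. The nullcone $N_{\mathbf d}\subset R_{\mathbf d}$ is the closed subvariety (with reduced structure) of those $V$ such that $0$ lies in the closure of $G_{\mathbf d}\cdot V$; equivalently, such that $V_{\alpha_1}\circ\cdots\circ V_{\alpha_s}$ is nilpotent for every oriented cycle $\alpha_1\cdots\alpha_s$ in $Q$; equivalently, such that $V$ has a filtration by subrepresentations whose subquotients are among the one-dimensional representations $S_i$ ($i\in Q_0$) concentrated at vertex $i$ with all arrows acting as zero. $K_0(\mathrm{Var}_{\mathbb C})$ is the Grothendieck ring of complex varieties, $[X]$ the class of $X$, $\mathbb{L}=[\mathbb{A}^1]$. Put $\dim\mathbf{d}=\sum_i d_i$, $(q)_n=(1-q)\cdots(1-q^n)$, $\left[{n\atop k}\right]_q=\frac{(q)_n}{(q)_k(q)_{n-k}}\in\mathbb{Z}[q]$, and $\left[{\mathbf{d}\atop\mathbf{e}}\right]_q=\prod_{i\in Q_0}\left[{d_i\atop e_i}\right]_q$. *)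

(* Defs.v *)
From HB Require Import structures.
From mathcomp Require Import all_boot all_order all_algebra complex.
From mathcomp Require Import boolp classical_sets reals.
From mathcomp Require Import ring zify.
From mathcomp Require Import ring zify.

Set Implicit Arguments.
Unset Strict Implicit.
Unset Printing Implicit Defensive.
Import Order.TTheory GRing.Theory Num.Theory.

Local Open Scope classical_set_scope.
Local Open Scope ring_scope.

(* Varieties are taken in the classical sense: spaces with a sheaf of k-valued
   functions that are separated and have a finite affine open cover; over an
   algebraically closed field they are the same as reduced separated schemes of
   finite type. A variety has at most as many points as k has finite sequences,
   so up to isomorphism its underlying set is a set of finite sequences of
   elements of k. All underlying sets are taken of this form: no variety is
   lost, and the varieties form a small type, which is needed to form K_0. *)

Section Spaces.
Variable k : closedFieldType.
Implicit Types (U V A : set (seq k)) (f g : seq k -> k).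

(* A function on U is represented by any extension of it to seq k, whence
   [regular_ext]; [regular U] is only meaningful for open U. *)
Record funspace := FunSpace {
  points : set (seq k);
  isopen : set (seq k) -> Prop;
  regular : set (seq k) -> (seq k -> k) -> Prop;
  open_sub : forall U, isopen U -> U `<=` points;
  open_points : isopen points;
  openI : forall U V, isopen U -> isopen V -> isopen (U `&` V);
  open_bigcup : forall F : set (set (seq k)),
    (forall U, F U -> isopen U) -> isopen (\bigcup_(U in F) U);
  regular_ext : forall U f g,
    (forall x, U x -> f x = g x) -> regular U f -> regular U g;
  regular_res : forall U V f,
    isopen U -> isopen V -> V `<=` U -> regular U f -> regular V f;
  regular_glue : forall U f, isopen U ->
    (forall x, U x -> exists V,
       [/\ isopen V, V x, V `<=` U & regular V f]) -> regular U f;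
  regular_cst : forall U (c : k), isopen U -> regular U (fun=> c);
  regularD : forall U f g, isopen U ->
    regular U f -> regular U g -> regular U (fun x => f x + g x);
  regularM : forall U f g, isopen U ->
    regular U f -> regular U g -> regular U (fun x => f x * g x);
  regular_neq0 : forall U f, isopen U -> regular U f ->
    isopen (U `&` [set x | f x != 0]);
  regularV : forall U f, isopen U -> regular U f ->
    regular (U `&` [set x | f x != 0]) (fun x => (f x)^-1)
}.

Definition isclosed (X : funspace) A :=
  A `<=` points X /\ isopen X (points X `\` A).

Definition regular_map (X Y : funspace) (h : seq k -> seq k) :=
  [/\ forall x, points X x -> points Y (h x),
      forall V, isopen Y V -> isopen X (points X `&` h @^-1` V)
    & forall V f, isopen Y V -> regular Y V f ->
        regular X (points X `&` h @^-1` V) (f \o h)].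

Definition isomorphic (X Y : funspace) :=
  exists h h', [/\ regular_map X Y h, regular_map Y X h',
    forall x, points X x -> h' (h x) = x
  & forall y, points Y y -> h (h' y) = y].

Lemma isomorphic_refl X : isomorphic X X.
Proof.
suff idX : regular_map X X id by exists id, id.
have E V : isopen X V -> points X `&` id @^-1` V = V.
  by move=> /open_sub VX; rewrite setIC setIidl.
by split=> // [V Vo | V f Vo Vf]; rewrite E.
Qed.

Lemma regular_map_comp X Y Z h1 h2 :
  regular_map X Y h1 -> regular_map Y Z h2 -> regular_map X Z (h2 \o h1).
Proof.
move=> [m1 o1 r1] [m2 o2 r2].
have E V : points X `&` (h2 \o h1) @^-1` V =
           points X `&` h1 @^-1` (points Y `&` h2 @^-1` V).
  by apply/seteqP; split=> x /= [Xx Vx]; split=> //;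
    [split=> //; apply: m1 | case: Vx].
split=> [x Xx | V Vo | V f Vo Vf].
- exact/m2/m1.
- by rewrite E; apply/o1/o2.
- by rewrite E; apply: (r1 _ (f \o h2) (o2 _ Vo)); apply: r2.
Qed.

Section Subspace.
Variables (X : funspace) (A : set (seq k)).

Let sub_open U := exists2 V, isopen X V & U = V `&` A.

Let sub_regular U f := forall x, U x -> exists V g,
  [/\ isopen X V, V x, regular X V g & forall y, (V `&` U) y -> f y = g y].

Let sub_open_local U : U `<=` A ->
  (forall x, U x -> exists V, [/\ isopen X V, V x & V `&` A `<=` U]) ->
  sub_open U.
Proof.
move=> UA Uloc; pose F := [set V | isopen X V /\ V `&` A `<=` U].
exists (\bigcup_(V in F) V); first by apply: open_bigcup => V [].
apply/seteqP; split=> [x Ux | x [[V [_ +] Vx] Ax]]; last exact.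
split; last exact: UA.
by have [V [Vo Vx VU]] := Uloc x Ux; exists V.
Qed.

Let sub_regular_neq0 U f : sub_open U -> sub_regular U f ->
  sub_open (U `&` [set x | f x != 0]).
Proof.
move=> [W Wo ->] Uf; apply: sub_open_local => [x [[]]|] // x [[Wx Ax] /= fx].
have [V [g [Vo Vx Vg fg]]] := Uf x (conj Wx Ax).
exists (W `&` (V `&` [set y | g y != 0])); split.
- exact/openI/regular_neq0.
- by split=> //; split=> //=; rewrite -fg.
- by move=> y [[Wy [Vy gy]] Ay]; split=> //=; rewrite fg.
Qed.

Definition subspace : funspace.
Proof.
refine (@FunSpace (points X `&` A) sub_open sub_regular
  _ _ _ _ _ _ _ _ _ _ sub_regular_neq0 _).
- by move=> _ [V /open_sub VX ->] x [/VX].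
- by exists (points X) => //; apply: open_points.
- move=> _ _ [V Vo ->] [W Wo ->]; exists (V `&` W); first exact: openI.
  by rewrite setIACA setIid.
- move=> F Fo; apply: sub_open_local => [x [U /Fo [V _ ->] []] // | x].
  move=> [U FU]; have [V Vo UE] := Fo U FU; rewrite UE => -[Vx Ax].
  by exists V; split=> // y ?; exists U; rewrite // UE.
- move=> U f g fg Uf x Ux; have [V [h [Vo Vx Vh fh]]] := Uf x Ux.
  by exists V, h; split=> // y Vy; rewrite -fh // fg //; case: Vy.
- move=> U V f _ _ VU Uf x Vx; have [W [h [? ? ? fh]]] := Uf x (VU x Vx).
  by exists W, h; split=> // y [Wy Vy]; apply: fh; split=> //; apply: VU.
- move=> U f Uo Uf x Ux; have [_ [[V Vo ->] Vx VU Vf]] := Uf x Ux.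
  have [W [h [Wo Wx Wh fh]]] := Vf x Vx.
  exists (V `&` W), h; split=> //; first exact: openI.
  + by case: Vx.
  + apply: regular_res Wh => //; first exact: openI.
  + move=> y [[Vy Wy] Uy]; apply: fh; split=> //; split=> //.
    by case: Uo Uy => ? _ -> [].
- move=> U c [V Vo ->] x [Vx Ax]; exists V, (fun=> c).
  by split=> //; apply: regular_cst.
- move=> U f g _ Uf Ug x Ux; have [V [f' [Vo Vx Vf' ff]]] := Uf x Ux.
  have [W [g' [Wo Wx Wg' gg]]] := Ug x Ux.
  exists (V `&` W), (fun x => f' x + g' x); split=> //; first exact: openI.
    apply: regularD; first exact: openI.
      by apply: regular_res Vf' => //; apply: openI.
    by apply: regular_res Wg' => //; apply: openI.
  by move=> y [[Vy Wy] Uy]; rewrite ff ?gg.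
- move=> U f g _ Uf Ug x Ux; have [V [f' [Vo Vx Vf' ff]]] := Uf x Ux.
  have [W [g' [Wo Wx Wg' gg]]] := Ug x Ux.
  exists (V `&` W), (fun x => f' x * g' x); split=> //; first exact: openI.
    apply: regularM; first exact: openI.
      by apply: regular_res Vf' => //; apply: openI.
    by apply: regular_res Wg' => //; apply: openI.
  by move=> y [[Vy Wy] Uy]; rewrite ff ?gg.
- move=> U f _ Uf x [Ux /= fx]; have [V [g [Vo Vx Vg fg]]] := Uf x Ux.
  exists (V `&` [set y | g y != 0]), (fun x => (g x)^-1); split.
  + exact: regular_neq0.
  + by split=> //=; rewrite -fg.
  + exact: regularV.
  + by move=> y [[Vy _] [Uy _]]; rewrite fg.
Defined.

Lemma regular_map_subspace : regular_map subspace X id.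
Proof.
have E V : isopen X V -> points subspace `&` id @^-1` V = V `&` A.
  move=> /open_sub VX; apply/seteqP; split=> x /= [].
    by move=> [].
  by move=> Vx; split=> //; split=> //; apply: VX.
split=> [x [] | V Vo | V f Vo Vf] //; rewrite E //; first by exists V.
by move=> x [Vx _]; exists V, f; split.
Qed.

End Subspace.

Lemma subspace_points X : isomorphic (subspace X (points X)) X.
Proof.
have E V : isopen X V -> points X `&` id @^-1` V = V.
  by move=> /open_sub VX; rewrite setIC setIidl.
exists id, id; split=> //; first exact: regular_map_subspace.
split=> [x //|V [W Wo ->]|V f [W Wo ->] Vf].
  rewrite E //; last exact/openI/open_points.
  exact/openI/open_points.
rewrite E; last exact/openI/open_points.
apply: regular_glue; first exact/openI/open_points.
move=> x Wx; have [V' [g [V'o V'x V'g fg]]] := Vf x Wx.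
have V'o2 : isopen X (V' `&` (W `&` points X)).
  by apply: openI => //; apply/openI/open_points.
exists (V' `&` (W `&` points X)); split=> //.
apply: (@regular_ext X _ g); first by move=> y Vy; rewrite /= fg.
by apply: (regular_res V'o V'o2 _ V'g) => y [].
Qed.

Section AffineSpace.
Variable n : nat.

Inductive polyfun : (seq k -> k) -> Prop :=
| polyfun_cst (c : k) : polyfun (fun=> c)
| polyfun_coord (i : 'I_n) : polyfun (fun x => x`_i)
| polyfunD f g : polyfun f -> polyfun g -> polyfun (fun x => f x + g x)
| polyfunM f g : polyfun f -> polyfun g -> polyfun (fun x => f x * g x).

Definition affine_points : set (seq k) := [set x | size x = n].

Definition zero_locus (S : set (seq k -> k)) : set (seq k) :=
  [set x | affine_points x /\ forall f, S f -> f x = 0].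

Definition zopen U := exists2 S, S `<=` polyfun
  & U = affine_points `\` zero_locus S.

Definition zregular U f := forall x, U x -> exists V g h,
  [/\ zopen V /\ V x, V `<=` U, polyfun g, polyfun h
    & forall y, V y -> h y != 0 /\ f y = g y / h y].

Lemma zopen_local U : U `<=` affine_points ->
  (forall x, U x -> exists h,
     [/\ polyfun h, h x != 0 & forall y, affine_points y -> h y != 0 -> U y]) ->
  zopen U.
Proof.
move=> Un Uloc; exists [set h | polyfun h /\
  forall y, affine_points y -> h y != 0 -> U y]; first by move=> h [].
apply/seteqP; split=> x.
  move=> Ux; split; first exact: Un.
  have [h [ph hx hU]] := Uloc x Ux.
  by move=> [_ /(_ h (conj ph hU))] /eqP; apply/negP.
move=> [nx Zx]; apply: contrapT => nUx; apply: Zx; split=> // h [ph hU].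
by apply/eqP/negPn/negP => hx; apply: nUx; apply: hU.
Qed.

Lemma zopenP U x : zopen U -> U x -> exists h,
     [/\ polyfun h, h x != 0 & forall y, affine_points y -> h y != 0 -> U y].
Proof.
move=> [S Sp ->] [nx Zx].
have [h Sh hx] : exists2 h, S h & h x != 0.
  apply: contrapT => H; apply: Zx; split=> // h Sh.
  by apply/eqP/negPn/negP => hx; apply: H; exists h.
exists h; split=> //; first exact: Sp.
by move=> y ny hy; split=> // -[_ /(_ h Sh)] /eqP; apply/negP.
Qed.

Lemma zopen_sub U : zopen U -> U `<=` affine_points.
Proof. by move=> [S _ ->] x []. Qed.

Lemma zopenI U V : zopen U -> zopen V -> zopen (U `&` V).
Proof.
move=> Uo Vo; apply: zopen_local => [x [/(zopen_sub Uo)] //|x [Ux Vx]].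
have [h [ph hx hU]] := zopenP Uo Ux; have [g [pg gx gV]] := zopenP Vo Vx.
exists (fun x => h x * g x); split; first exact: polyfunM.
  by rewrite mulf_neq0.
by move=> y ny; rewrite mulf_eq0 negb_or => /andP[hy gy]; split; auto.
Qed.

Lemma zopen_neq0 U h : zopen U -> polyfun h -> zopen (U `&` [set x | h x != 0]).
Proof.
move=> Uo ph; apply: zopen_local => [x [/(zopen_sub Uo)] //|x [Ux hx]].
have [g [pg gx gU]] := zopenP Uo Ux.
exists (fun x => h x * g x); split; first exact: polyfunM.
  by rewrite mulf_neq0.
by move=> y ny; rewrite mulf_eq0 negb_or => /andP[hy gy]; split; auto.
Qed.

Let zregular_neq0 U f : zopen U -> zregular U f ->
  zopen (U `&` [set x | f x != 0]).
Proof.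
move=> Uo Uf; apply: zopen_local => [x [/(zopen_sub Uo)] //|x [Ux /= fx]].
have [V [g [h [[Vo Vx] VU pg ph fE]]]] := Uf x Ux.
have [l [pl lx lV]] := zopenP Vo Vx.
exists (fun x => l x * g x); split; first exact: polyfunM.
  rewrite mulf_neq0 //; apply: contra fx => /eqP gx.
  by rewrite (fE x Vx).2 gx mul0r.
move=> y ny; rewrite mulf_eq0 negb_or => /andP[ly gy].
have Vy := lV y ny ly; split; first exact: VU.
by rewrite /= (fE y Vy).2 mulf_neq0 // invr_neq0 // (fE y Vy).1.
Qed.

Definition affine : funspace.
Proof.
refine (@FunSpace affine_points zopen zregular
  zopen_sub _ zopenI _ _ _ _ _ _ _ zregular_neq0 _).
- apply: zopen_local => // x nx; exists (fun=> 1); split=> //.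
    exact: polyfun_cst.
  exact: oner_neq0.
- move=> F Fo; apply: zopen_local => [x [U /Fo /zopen_sub Un /Un] //|x].
  move=> [U FU Ux]; have [h [ph hx hU]] := zopenP (Fo U FU) Ux.
  by exists h; split=> // y ny hy; exists U => //; apply: hU.
- move=> U f g fg Uf x Ux; have [V [p [q [? VU ? ? H]]]] := Uf x Ux.
  exists V, p, q; split=> // y Vy; rewrite -fg; [exact: H|exact: VU].
- move=> U V f _ Vo VU Uf x Vx.
  have [W [p [q [[Wo Wx] WU ? ? H]]]] := Uf x (VU x Vx).
  exists (W `&` V), p, q; split=> //; first by split=> //; apply: zopenI.
  by move=> y [Wy _]; apply: H.
- move=> U f _ Uf x Ux; have [V [Vo Vx VU Vf]] := Uf x Ux.
  have [W [p [q [? WV ? ? H]]]] := Vf x Vx.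
  by exists W, p, q; split=> // y /WV /VU.
- move=> U c Uo x Ux; exists U, (fun=> c), (fun=> 1).
  split=> //; try exact: polyfun_cst.
  by move=> y _; rewrite oner_neq0 divr1.
- move=> U f g _ Uf Ug x Ux.
  have [V [p [q [[Vo Vx] VU pp pq H]]]] := Uf x Ux.
  have [V' [p' [q' [[Vo' Vx'] VU' pp' pq' H']]]] := Ug x Ux.
  exists (V `&` V'), (fun x => p x * q' x + p' x * q x), (fun x => q x * q' x).
  split.
  + by split=> //; apply: zopenI.
  + by move=> y [/VU].
  + by apply: polyfunD; apply: polyfunM.
  + exact: polyfunM.
  + move=> y [Vy Vy']; have [qy ->] := H y Vy; have [qy' ->] := H' y Vy'.
    by rewrite mulf_neq0 // addf_div.
- move=> U f g _ Uf Ug x Ux.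
  have [V [p [q [[Vo Vx] VU pp pq H]]]] := Uf x Ux.
  have [V' [p' [q' [[Vo' Vx'] VU' pp' pq' H']]]] := Ug x Ux.
  exists (V `&` V'), (fun x => p x * p' x), (fun x => q x * q' x); split.
  + by split=> //; apply: zopenI.
  + by move=> y [/VU].
  + exact: polyfunM.
  + exact: polyfunM.
  + move=> y [Vy Vy']; have [qy ->] := H y Vy; have [qy' ->] := H' y Vy'.
    by rewrite mulf_neq0 // mulf_div.
- move=> U f Uo Uf x [Ux /= fx].
  have [V [p [q [[Vo Vx] VU pp pq H]]]] := Uf x Ux.
  have px y : V y -> (p y != 0) = (f y != 0).
    move=> Vy; have [qy ->] := H y Vy.
    by rewrite mulf_eq0 invr_eq0 (negPf qy) orbF.
  exists (V `&` [set x | p x != 0]), q, p; split=> //.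
  + by split; [apply: zopen_neq0 | split=> //=; rewrite px].
  + by move=> y [Vy /=]; rewrite px //; split=> //; apply: VU.
  + by move=> y [Vy py]; split=> //; rewrite (H y Vy).2 invf_div.
Defined.

Lemma polyfun_regular U f : zopen U -> polyfun f -> regular affine U f.
Proof.
move=> Uo pf x Ux; exists U, f, (fun=> 1); split=> //; first exact: polyfun_cst.
by move=> y _; rewrite oner_neq0 divr1.
Qed.

Lemma zero_locus_closed S : S `<=` polyfun -> isclosed affine (zero_locus S).
Proof. by move=> Sp; split=> [x []|] //; exists S. Qed.

End AffineSpace.

Definition is_affine (X : funspace) := exists n Z,
  isclosed (affine n) Z /\ isomorphic X (subspace (affine n) Z).

Definition has_affine_cover (X : funspace) :=
  exists m (U : 'I_m -> set (seq k)),
    [/\ forall i, isopen X (U i), points X = \bigcup_i U i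
      & forall i, is_affine (subspace X (U i))].

Definition is_separated (X : funspace) := forall (Y : funspace) h h',
  regular_map Y X h -> regular_map Y X h' ->
  isclosed Y (points Y `&` [set y | h y = h' y]).

Record variety := Variety {
  space :> funspace;
  affine_cover : has_affine_cover space;
  separated : is_separated space
}.

Lemma affine_has_affine_cover X : is_affine X -> has_affine_cover X.
Proof.
move=> [n [Z [Zc [h [h' [mh mh' hK h'K]]]]]].
exists 1%N, (fun=> points X); split=> [_||_]; first exact: open_points.
  by apply/seteqP; split=> [x Xx | x [] //]; exists ord0.
exists n, Z; split=> //.
have [p [p' [mp mp' pK p'K]]] := subspace_points X.
exists (h \o p), (p' \o h'); split=> [||x Px|x Px] /=.
- exact: regular_map_comp mp mh.
- exact: regular_map_comp mh' mp'.
- by rewrite hK ?pK //; case: mp => + _ _; apply.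
- by rewrite p'K ?h'K //; case: mh' => + _ _; apply.
Qed.

Lemma affine_separated n : is_separated (affine n).
Proof.
move=> Y h h' mh mh'; split=> [y []|] //.
have coord (p : seq k -> seq k) (i : 'I_n) : regular_map Y (affine n) p ->
    regular Y (points Y) (fun y => (p y)`_i).
  move=> [mp op rp].
  have E : points Y = points Y `&` p @^-1` affine_points n.
    by apply/seteqP; split=> [y Yy | y []//]; split=> //; apply: mp.
  rewrite {1}E; apply: (rp _ (fun x => x`_i)); first exact: open_points (affine n).
  by apply: polyfun_regular; [exact: open_points (affine n)|exact: polyfun_coord].
pose e i y := (h y)`_i + -1 * (h' y)`_i.
have re (i : 'I_n) : regular Y (points Y) (e i).
  have Yo := open_points Y.
  apply: regularD (coord h i mh) _ => //.
  by apply: regularM (coord h' i mh') => //; apply: regular_cst.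
have -> : points Y `\` (points Y `&` [set y | h y = h' y]) =
  \bigcup_(U in [set U | exists i : 'I_n, U = points Y `&` [set y | e i y != 0]]) U.
  apply/seteqP; split=> y.
    move=> [Yy neq]; apply: contrapT => H; apply: neq; split=> //=.
    have [[+ _ _] [+ _ _]] := (mh, mh') => /(_ y Yy) sz /(_ y Yy) sz'.
    apply: (@eq_from_nth _ 0); first by rewrite sz sz'.
    rewrite sz => i ltin; apply/eqP; rewrite -subr_eq0 -mulN1r.
    apply/negPn/negP => ne; apply: H.
    by exists (points Y `&` [set y | e (Ordinal ltin) y != 0]) => //;
      exists (Ordinal ltin).
  move=> [_ [i ->] [Yy /= ei]]; split=> // -[_ hh'].
  by move: ei; rewrite /e hh' mulN1r subrr eqxx.
apply: open_bigcup => _ [i ->]; apply: regular_neq0 => //.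
exact: open_points.
Qed.

Lemma subspace_separated X A : is_separated X -> is_separated (subspace X A).
Proof.
move=> sX Y h h' mh mh'.
have mi := regular_map_subspace X A.
exact: (sX Y (id \o h) (id \o h') (regular_map_comp mh mi) (regular_map_comp mh' mi)).
Qed.

Definition affine_space (n : nat) : variety.
Proof.
apply: (@Variety (affine n)); last exact: affine_separated.
exists 1%N, (fun=> affine_points n); split=> [_||_].
- exact: open_points (affine n).
- by apply/seteqP; split=> [x Xx | x [] //]; exists ord0.
- exists n, (affine_points n); split; last exact: isomorphic_refl.
  split=> //; rewrite setDv.
  by apply: zopen_local.
Defined.

Definition closed_subvariety n Z (Zc : isclosed (affine n) Z) : variety.
Proof.
apply: (@Variety (subspace (affine n) Z)).
  by apply: affine_has_affine_cover; exists n, Z; split=> //; apply: isomorphic_refl.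
exact/subspace_separated/affine_separated.
Defined.

(* The universal property of the product in the category of varieties. *)
Definition is_product (X Y P : variety) := exists p q,
  [/\ regular_map P X p, regular_map P Y q
    & forall (T : variety) u v, regular_map T X u -> regular_map T Y v ->
      (exists2 h, regular_map T P h &
         forall t, points T t -> p (h t) = u t /\ q (h t) = v t) /\
      (forall h h', regular_map T P h -> regular_map T P h' ->
         (forall t, points T t -> p (h t) = p (h' t) /\ q (h t) = q (h' t)) ->
         forall t, points T t -> h t = h' t)].

End Spaces.

Section GrothendieckRing.
Variable k : closedFieldType.

(* K_0(Var_k) is presented as the commutative ring generated by the varieties,
   subject to the relations [K0_iso], [K0_scissor], [K0_product], [K0_point]. *)
Inductive K0_expr :=
| K0_var (X : variety k)
| K0_zero
| K0_one
| K0_opp (x : K0_expr)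
| K0_add (x y : K0_expr)
| K0_mul (x y : K0_expr).

Inductive K0_eq : K0_expr -> K0_expr -> Prop :=
| K0_refl x : K0_eq x x
| K0_sym x y : K0_eq x y -> K0_eq y x
| K0_trans x y z : K0_eq x y -> K0_eq y z -> K0_eq x z
| K0_oppE x x' : K0_eq x x' -> K0_eq (K0_opp x) (K0_opp x')
| K0_addE x x' y y' :
    K0_eq x x' -> K0_eq y y' -> K0_eq (K0_add x y) (K0_add x' y')
| K0_mulE x x' y y' :
    K0_eq x x' -> K0_eq y y' -> K0_eq (K0_mul x y) (K0_mul x' y')
| K0_addA x y z : K0_eq (K0_add x (K0_add y z)) (K0_add (K0_add x y) z)
| K0_addC x y : K0_eq (K0_add x y) (K0_add y x)
| K0_add0 x : K0_eq (K0_add K0_zero x) x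
| K0_addN x : K0_eq (K0_add (K0_opp x) x) K0_zero
| K0_mulA x y z : K0_eq (K0_mul x (K0_mul y z)) (K0_mul (K0_mul x y) z)
| K0_mulC x y : K0_eq (K0_mul x y) (K0_mul y x)
| K0_mul1 x : K0_eq (K0_mul K0_one x) x
| K0_mulD x y z :
    K0_eq (K0_mul (K0_add x y) z) (K0_add (K0_mul x z) (K0_mul y z))
| K0_iso (X Y : variety k) : isomorphic X Y -> K0_eq (K0_var X) (K0_var Y)
| K0_scissor (X Z U : variety k) A : isclosed X A ->
    isomorphic Z (subspace X A) -> isomorphic U (subspace X (points X `\` A)) ->
    K0_eq (K0_var X) (K0_add (K0_var Z) (K0_var U))
| K0_product (X Y P : variety k) : is_product X Y P ->
    K0_eq (K0_mul (K0_var X) (K0_var Y)) (K0_var P)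
| K0_point : K0_eq (K0_var (affine_space k 0)) K0_one.

HB.instance Definition _ := gen_eqMixin K0_expr.
HB.instance Definition _ := gen_choiceMixin K0_expr.

Local Open Scope quotient_scope.

Definition K0_rel (x y : K0_expr) := `[< K0_eq x y >].

Lemma K0_rel_equiv : equiv_class_of K0_rel.
Proof.
split=> [x | x y | y x z].
- exact/asboolP/K0_refl.
- by apply/asboolP/asboolP; apply: K0_sym.
- by move=> /asboolP xy /asboolP yz; apply/asboolP; apply: K0_trans xy yz.
Qed.

Canonical K0_equiv := EquivRelPack K0_rel_equiv.

Definition K0 := {eq_quot K0_equiv}.
HB.instance Definition _ := Choice.on K0.
HB.instance Definition _ := EqQuotient.on K0.

Lemma K0_pi x y : reflect (\pi_K0 x = \pi_K0 y) (K0_rel x y).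
Proof. by apply: (iffP idP) => /eqmodP. Qed.

Lemma K0_repr x : K0_eq (repr (\pi_K0 x)) x.
Proof. by apply/asboolP/K0_pi; rewrite reprK. Qed.

Lemma K0W (P : K0 -> Prop) : (forall x, P (\pi_K0 x)) -> forall a, P a.
Proof. by move=> Px a; rewrite -[a]reprK; apply: Px. Qed.

Definition K0N (a : K0) : K0 := \pi_K0 (K0_opp (repr a)).
Definition K0D (a b : K0) : K0 := \pi_K0 (K0_add (repr a) (repr b)).
Definition K0M (a b : K0) : K0 := \pi_K0 (K0_mul (repr a) (repr b)).

Lemma K0N_pi x : K0N (\pi_K0 x) = \pi_K0 (K0_opp x).
Proof. by apply/K0_pi/asboolP/K0_oppE/K0_repr. Qed.

Lemma K0D_pi x y : K0D (\pi_K0 x) (\pi_K0 y) = \pi_K0 (K0_add x y).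
Proof. by apply/K0_pi/asboolP/K0_addE; apply: K0_repr. Qed.

Lemma K0M_pi x y : K0M (\pi_K0 x) (\pi_K0 y) = \pi_K0 (K0_mul x y).
Proof. by apply/K0_pi/asboolP/K0_mulE; apply: K0_repr. Qed.

Fact K0DA : associative K0D.
Proof.
elim/K0W=> x; elim/K0W=> y; elim/K0W=> z.
by rewrite !K0D_pi; apply/K0_pi/asboolP; exact: K0_addA.
Qed.

Fact K0DC : commutative K0D.
Proof.
elim/K0W=> x; elim/K0W=> y.
by rewrite !K0D_pi; apply/K0_pi/asboolP; exact: K0_addC.
Qed.

Fact K0D0 : left_id (\pi_K0 K0_zero) K0D.
Proof.
by elim/K0W=> x; rewrite !K0D_pi; apply/K0_pi/asboolP; exact: K0_add0.
Qed.

Fact K0DN : left_inverse (\pi_K0 K0_zero) K0N K0D.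
Proof.
by elim/K0W=> x; rewrite K0N_pi K0D_pi; apply/K0_pi/asboolP; exact: K0_addN.
Qed.

HB.instance Definition _ := GRing.isZmodule.Build K0 K0DA K0DC K0D0 K0DN.

Fact K0MA : associative K0M.
Proof.
elim/K0W=> x; elim/K0W=> y; elim/K0W=> z.
by rewrite !K0M_pi; apply/K0_pi/asboolP; exact: K0_mulA.
Qed.

Fact K0MC : commutative K0M.
Proof.
elim/K0W=> x; elim/K0W=> y.
by rewrite !K0M_pi; apply/K0_pi/asboolP; exact: K0_mulC.
Qed.

Fact K0M1 : left_id (\pi_K0 K0_one) K0M.
Proof.
by elim/K0W=> x; rewrite !K0M_pi; apply/K0_pi/asboolP; exact: K0_mul1.
Qed.

Fact K0MD : left_distributive K0M K0D.
Proof.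
elim/K0W=> x; elim/K0W=> y; elim/K0W=> z.
by rewrite K0D_pi !K0M_pi K0D_pi; apply/K0_pi/asboolP; exact: K0_mulD.
Qed.

HB.instance Definition _ :=
  GRing.Zmodule_isComPzRing.Build K0 K0MA K0MC K0M1 K0MD.

Definition K0_class (X : variety k) : K0 := \pi_K0 (K0_var X).

Definition Lefschetz : K0 := K0_class (affine_space k 1).

End GrothendieckRing.

(* [horner] needs a nontrivial ring, and K_0 is only known to be a comPzRingType
   here. *)
Definition eval_int (A : comPzRingType) (p : {poly int}) (x : A) : A :=
  \sum_(i < size p) x ^+ i *~ p`_i.

Section QBinomial.

Definition qfact (n : nat) : {poly int} := \prod_(1 <= i < n.+1) (1 - 'X^i).

(* The leading coefficient of [qfact n] is 1 or -1, so this is a Euclidean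
   division in Z[q]; it is exact by [qbinomE]. *)
Definition qbinom (n m : nat) : {poly int} :=
  qfact n %/ (qfact m * qfact (n - m)).

Lemma qfact0 : qfact 0 = 1.
Proof. by rewrite /qfact big_geq. Qed.

Lemma qfactS n : qfact n.+1 = qfact n * (1 - 'X^(n.+1)).
Proof. by rewrite /qfact big_nat_recr. Qed.

Lemma qfact_lead n : lead_coef (qfact n) \is a GRing.unit.
Proof.
elim: n => [|n IHn]; first by rewrite qfact0 lead_coef1 unitr1.
rewrite qfactS lead_coefM unitrM IHn /= -opprB lead_coefN unitrN.
by rewrite (eqP (monicXnsubC 1 (ltn0Sn n))) unitr1.
Qed.

Lemma qbinom_ex n m : (m <= n)%N ->
  exists b, qfact n = b * (qfact m * qfact (n - m)).
Proof.
elim: n m => [|n IHn] [|m] //= le_mn.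
- by exists 1; rewrite subnn !qfact0 !mulr1.
- by exists 1; rewrite subn0 !qfact0 !mul1r.
have [b1 E1] := IHn m le_mn; rewrite subSS.
have [->|ne_mn] := eqVneq m n.
  by exists 1; rewrite subnn qfact0 mulr1 mul1r.
have lt_mn : (m < n)%N by rewrite ltn_neqAle ne_mn.
have [b2 E2] := IHn m.+1 lt_mn.
exists (b1 + 'X^(m.+1) * b2).
have EQ : qfact (n - m) = qfact (n - m.+1) * (1 - 'X^(n - m)).
  by rewrite -(subnSK lt_mn) qfactS.
have EX : 'X^(n.+1) = 'X^(m.+1) * 'X^(n - m) :> {poly int}.
  by rewrite -exprD addSn subnKC // ltnW.
transitivity (qfact n * (1 - 'X^(m.+1)) + qfact n * ('X^(m.+1) * (1 - 'X^(n - m)))).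
  by rewrite qfactS EX; ring.
by rewrite {1}E1 E2 EQ qfactS; ring.
Qed.

Lemma qbinomE n m : (m <= n)%N ->
  qbinom n m * (qfact m * qfact (n - m)) = qfact n.
Proof.
move=> /qbinom_ex[b E]; rewrite /qbinom E Pdiv.IdomainUnit.mulpK //.
by rewrite lead_coefM unitrM !qfact_lead.
Qed.

End QBinomial.

Section MatrixLemmas.
Variable k : numClosedFieldType.

Lemma idempotent_tr0 n (E : 'M[k]_n) : E *m E = E -> \tr E = 0 -> E = 0.
Proof.
move=> EE trE.
have BC : row_base E *m col_base E = 1%:M.
  apply: (row_free_inj (row_base_free E)).
  apply: (row_full_inj (col_base_full E)).
  have := mulmx_base E; move: (col_base E) (row_base E) => C B CB.
  by rewrite mul1mx CB -!mulmxA CB mulmxA CB.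
move: trE; rewrite -(mulmx_base E) mxtrace_mulC BC mxtrace1 => /eqP.
by rewrite pnatr_eq0 mxrank_eq0 => /eqP ->; rewrite mulmx_base.
Qed.

Lemma tr_nilpotent n (M : 'M[k]_n) :
  (forall j, \tr (M ^+ j.+1) = 0) -> exists m, M ^+ m = 0.
Proof.
case: n M => [|n] M trM; first by exists 0%N; rewrite flatmx0.
have trh p j : \tr (horner_mx M p * M ^+ j.+1) = 0.
  elim/poly_ind: p j => [|p c IHp] j; first by rewrite rmorph0 mul0r mxtrace0.
  rewrite rmorphD rmorphM /= horner_mx_X horner_mx_C mulrDl mxtraceD.
  rewrite -mulrA -exprS IHp add0r -[_ * _]/(_ *m _) mul_scalar_mx mxtraceZ.
  by rewrite trM mulr0.
have [m [q q0 pE]] := multiplicity_XsubC (char_poly M) 0.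
move: pE; rewrite subr0 => pE.
rewrite (monic_neq0 (char_poly_monic M)) /= in q0.
have hX j : horner_mx M 'X^j = M ^+ j by rewrite rmorphXn /= horner_mx_X.
have CH : horner_mx M q * M ^+ m = 0.
  by rewrite -hX -rmorphM /= -pE Cayley_Hamilton.
have cop : coprimep q ('X ^+ m.+1).
  by rewrite coprimep_expr // -['X]subr0 -polyC0 coprimep_XsubC.
have /Bezout_coprimepP[[u v] /= /eqpP[[c c'] /= /andP[c0 c'0] Ec]] := cop.
pose U := horner_mx M u; pose Y := horner_mx M v * M ^+ m.+1.
have UY : U * horner_mx M q + Y = (c'/c)%:M.
  have H : c *: (U * horner_mx M q + Y) = c'%:M.
    have := congr1 (horner_mx M) Ec.
    rewrite !linearZ /= rmorphD !rmorphM rmorphXn /= horner_mx_X rmorph1 => ->.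
    by rewrite -scalemx1.
  by apply: (scalerI c0); rewrite H scale_scalar_mx mulrC divfK.
have cc0 : c' / c != 0 by rewrite mulf_neq0 // invr_neq0.
pose E := (c' / c)^-1 *: Y.
have YU : Y * (U * horner_mx M q) = 0.
  rewrite /Y /U -hX -!rmorphM /=.
  have -> : v * 'X^(m.+1) * (u * q) = (v * 'X * u) * (q * 'X^m).
    by rewrite exprS; ring.
  by rewrite rmorphM /= [X in _ * X]rmorphM /= hX CH mulr0.
have YY : Y * Y = (c' / c) *: Y.
  have := congr1 (fun A => Y * A) UY; rewrite /= mulrDr YU add0r => ->.
  by rewrite -[_ * _]/(_ *m _) mul_mx_scalar.
have E0 : E = 0.
  apply: idempotent_tr0.
    rewrite /E -scalemxAl -scalemxAr -[Y *m Y]/(Y * Y) YY.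
    by rewrite [in X in _ *: X]scalerA mulVf // scale1r.
  by rewrite /E mxtraceZ trh mulr0.
have Y0 : Y = 0.
  by apply: (scalerI (invr_neq0 cc0)); rewrite scaler0.
exists m; move: UY; rewrite Y0 addr0 => UY.
have := congr1 (fun A => A * M ^+ m) UY; rewrite /= -mulrA CH mulr0.
rewrite -[_ * _]/(_ *m _) mul_scalar_mx => /esym/eqP.
by rewrite scaler_eq0 (negPf cc0) => /eqP.
Qed.

Lemma subspace_mx n (P : 'rV[k]_n -> Prop) :
  P 0 -> (forall c u v, P u -> P v -> P (c *: u + v)) ->
  exists K : 'M[k]_n, forall v, P v <-> (v <= K)%MS.
Proof.
move=> P0 PL.
pose good (K : 'M[k]_n) := forall v, (v <= K)%MS -> P v.
pose R r := `[< exists2 K : 'M[k]_n, good K & \rank K = r >].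
have exR : exists r, R r.
  by exists 0%N; apply/asboolP; exists 0; [move=> v; rewrite submx0 => /eqP -> | exact: mxrank0].
have ubR r : R r -> (r <= n)%N by move=> /asboolP[K _ <-]; exact: rank_leq_row.
case: (ex_maxnP exR ubR) => r /asboolP[K gK rK] rmax.
exists K => v; split=> [Pv|]; last exact: gK.
apply: contrapT => /negP nvK.
have gKv : good (K + v)%MS.
  move=> w /sub_addsmxP[[x y] ->] /=; rewrite addrC.
  rewrite [y]mx11_scalar mul_scalar_mx; apply: PL => //.
  by apply: gK; apply: submxMl.
have : (\rank (K + v)%MS <= r)%N by apply: rmax; apply/asboolP; exists (K + v)%MS.
rewrite -rK leqNgt => /negP; apply; apply: rank_ltmx.
rewrite ltmxE addsmxSl /=; apply: contra nvK => KvK.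
exact: submx_trans (addsmxSr K v) KvK.
Qed.

Section Words.
Variables (I : Type) (N : nat).
Implicit Types t : I -> 'M[k]_N.

Definition word t (w : seq I) : 'M[k]_N := foldr (fun a M => t a *m M) 1%:M w.

Lemma word_cat t w1 w2 : word t (w1 ++ w2) = word t w1 *m word t w2.
Proof. by elim: w1 => [|a w1 IH] /=; rewrite ?mul1mx // IH mulmxA. Qed.

Lemma word_conj t (G : 'M[k]_N) w : G \in unitmx ->
  word (fun a => G *m t a *m invmx G) w = G *m word t w *m invmx G.
Proof.
move=> Gu; elim: w => [|a w IH] /=; first by rewrite mulmx1 mulmxV.
by rewrite IH !mulmxA mulmxKV // -!mulmxA.
Qed.

Definition tr_nil t := forall w, w <> [::] -> \tr (word t w) = 0.

Inductive walg t : 'M[k]_N -> Prop :=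
| walg_word w : w <> [::] -> walg t (word t w)
| walg0 : walg t 0
| walgD c M M' : walg t M -> walg t M' -> walg t (c *: M + M').

Lemma walgM t M M' : walg t M -> walg t M' -> walg t (M *m M').
Proof.
move=> AM; elim=> [w' w'0||c B B' _ IH _ IH'].
- elim: AM => [w w0||c B B' _ IH _ IH'].
  + by rewrite -word_cat; apply: walg_word; case: w w0.
  + by rewrite mul0mx; apply: walg0.
  + by rewrite mulmxDl -scalemxAl; apply: walgD.
- by rewrite mulmx0; apply: walg0.
- by rewrite mulmxDr -scalemxAr; apply: walgD.
Qed.

Lemma walg_tr t M : tr_nil t -> walg t M -> \tr M = 0.
Proof.
move=> tn; elim=> [w /tn //||c B B' _ IH _ IH']; first exact: mxtrace0.
by rewrite mxtraceD mxtraceZ IH IH' mulr0 addr0.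
Qed.

Lemma walg_nilpotent t M : tr_nil t -> walg t M -> exists m, M ^+ m = 0.
Proof.
move=> tn AM; apply: tr_nilpotent => j; apply: (walg_tr tn).
by elim: j => [|j IH]; rewrite ?expr1 // exprS; apply: walgM.
Qed.

Definition supp_in (S : {set 'I_N}) (u : 'rV[k]_N) :=
  forall x, x \notin S -> u 0 x = 0.

Lemma supp_inP S c u v : supp_in S u -> supp_in S v -> supp_in S (c *: u + v).
Proof. by move=> Su Sv x xS; rewrite !mxE Su // Sv // mulr0 addr0. Qed.

(* A nil family has a common eigenvector modulo any stable proper coordinate
   subspace. *)
Lemma socle_step t (S : {set 'I_N}) : tr_nil t -> (exists x, x \notin S) ->
  (forall a u, supp_in S u -> supp_in S (u *m t a)) ->
  exists2 u, ~ supp_in S u & forall a, supp_in S (u *m t a).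
Proof.
move=> tn [x0 x0S] St.
have S0 : supp_in S 0 by move=> x _; rewrite mxE.
have Sw w u : supp_in S u -> supp_in S (u *m word t w).
  by elim: w u => [|a w IH] u Su /=; rewrite ?mulmx1 // mulmxA; apply/IH/St.
have SA M u : walg t M -> supp_in S u -> supp_in S (u *m M).
  move=> AM Su; elim: AM => [w _||c B B' _ IH _ IH']; first exact: Sw.
    by rewrite mulmx0.
  by rewrite mulmxDr -scalemxAr; apply: supp_inP.
pose sp (u v : 'rV[k]_N) := exists M s, [/\ walg t M, supp_in S s & v = u *m M + s].
have spK u : exists K : 'M[k]_N, forall v, sp u v <-> (v <= K)%MS.
  apply: subspace_mx.
    by exists 0, 0; split=> //; [exact: walg0 | rewrite mulmx0 addr0].
  move=> c _ _ [M [s [AM Ss ->]]] [M' [s' [AM' Ss' ->]]].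
  exists (c *: M + M'), (c *: s + s'); split; first exact: walgD.
    exact: supp_inP.
  by rewrite mulmxDr -scalemxAr scalerDr addrACA.
pose R r := `[< exists u (K : 'M[k]_N), [/\ ~ supp_in S u,
  forall v, sp u v <-> (v <= K)%MS & \rank K = r] >].
have exR : exists r, R r.
  have [K HK] := spK (delta_mx 0 x0); exists (\rank K); apply/asboolP.
  exists (delta_mx 0 x0), K; split=> // /(_ x0 x0S).
  by rewrite mxE !eqxx => /eqP; rewrite oner_eq0.
case: (ex_minnP exR) => r /asboolP[u [K [uS HK rK]]] rmin.
exists u => // a; apply: contrapT => vS; set v := u *m t a in vS.
have [K' HK'] := spK v.
have Aa : walg t (t a) by have := @walg_word t [:: a]; rewrite /= mulmx1; apply.
have sK : (K' <= K)%MS.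
  apply/row_subP => i; apply/HK.
  have /HK'[M [s [AM Ss ->]]] := row_sub i K'.
  by exists (t a *m M), s; split=> //; [apply: walgM | rewrite mulmxA].
have KK : (K <= K')%MS.
  rewrite -(geq_leqif (mxrank_leqif_sup sK)) rK; apply: rmin.
  by apply/asboolP; exists v, K'.
have vK : (v <= K)%MS.
  by apply/HK; exists (t a), 0; split=> //; rewrite addr0.
have /HK'[M [s [AM Ss vE]]] := submx_trans vK KK.
have [m Mm] := walg_nilpotent tn AM.
have vm j : supp_in S (v - v *m M ^+ j).
  elim: j => [|j IH]; first by rewrite expr0 mulmx1 subrr.
  rewrite {1}vE exprSr -[_ * M]/(_ *m M) mulmxA addrAC -mulmxBl addrC.
  by rewrite -[s]scale1r; apply: supp_inP => //; apply: SA.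
by apply: vS; have := vm m; rewrite Mm mulmx0 subr0.
Qed.

End Words.

Section Triangular.
Variables (I : Type) (J : finType) (N : nat).
Variables (t : I -> 'M[k]_N) (r : I -> J) (blk : 'I_N -> J).

Definition blkE j : 'M[k]_N := diag_mx (\row_x (blk x == j)%:R).

Lemma blkE_row j (u : 'rV[k]_N) x : (u *m blkE j) 0 x = u 0 x * (blk x == j)%:R.
Proof. by rewrite mul_mx_diag !mxE. Qed.

Hypothesis tn : tr_nil t.
Hypothesis tE : forall a j, blkE j *m t a = (j == r a)%:R *: t a.

Lemma strict_triangular : exists H : 'M[k]_N, exists w : 'I_N -> nat,
  [/\ H \in unitmx, forall j, H *m blkE j = blkE j *m H
    & forall a x y, (H *m t a *m invmx H) x y != 0 -> (w y < w x)%N].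
Proof.
suff main n : (n <= N)%N -> exists S : {set 'I_N},
    exists H : 'M[k]_N, exists w : 'I_N -> nat,
  [/\ #|S| = n, H \in unitmx, forall j, H *m blkE j = blkE j *m H
    & forall a x y, x \in S -> (H *m t a *m invmx H) x y != 0 ->
        (y \in S) && (w y < w x)%N].
  have [S [H [w [cS Hu HE HT]]]] := main N (leqnn N).
  exists H, w; split=> // a x y ne.
  suff xS : x \in S by case/andP: (HT a x y xS ne).
  suff /eqP -> : S == finset.setT by rewrite finset.inE.
  by rewrite finset.eqEcard finset.subsetT finset.cardsT card_ord cS /=.
elim: n => [_|n IHn ltnN].
  exists finset.set0, 1%:M, (fun=> 0%N); split=> [||j|a x y].
  - exact: cards0.
  - exact: unitmx1.
  - by rewrite mul1mx mulmx1.
  - by rewrite finset.inE.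
have [S [H [w [cS Hu HE HT]]]] := IHn (ltnW ltnN).
pose T a := H *m t a *m invmx H.
have exS : exists x, x \notin S.
  apply/existsP; rewrite -negb_forall; apply/negP => /forallP xS.
  have := cS; suff -> : S = finset.setT.
    by rewrite finset.cardsT card_ord => NE; rewrite NE ltnn in ltnN.
  by apply/setP => x; rewrite xS finset.inE.
have Tn : tr_nil T.
  by move=> v /tn tv; rewrite word_conj // mxtrace_mulC mulmxA mulVmx // mul1mx.
have ST a u : supp_in S u -> supp_in S (u *m T a).
  move=> Su y yS; rewrite mxE big1 // => x _.
  have [xS|/Su ->] := boolP (x \in S); last by rewrite mul0r.
  have [->|/(HT a x y xS)] := eqVneq (T a x y) 0; first by rewrite mulr0.
  by rewrite (negPf yS).
have [u uS uT] := socle_step Tn exS ST.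
have [x xS ux] : exists2 x, x \notin S & u 0 x != 0.
  apply: contrapT => nx; apply: uS => x xS; apply/eqP/negPn/negP => ux.
  by apply: nx; exists x.
pose i := blk x; pose e : 'rV[k]_N := delta_mx 0 x.
pose u' := (u 0 x)^-1 *: (u *m blkE i).
have u'x : u' 0 x = 1 by rewrite mxE blkE_row eqxx mulr1 mulVf.
have TE a : blkE i *m T a = (i == r a)%:R *: T a.
  by rewrite /T !mulmxA -HE -[_ *m _ *m t a]mulmxA tE -scalemxAr -scalemxAl.
have u'T a : supp_in S (u' *m T a).
  rewrite /u' -scalemxAl -mulmxA TE -scalemxAr scalerA.
  by move=> y yS; rewrite mxE uT ?mulr0.
pose y : 'rV[k]_N := u' - e; pose K := e^T *m y.
have ve (v : 'rV[k]_N) : v *m K = v 0 x *: y.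
  rewrite /K mulmxA trmx_delta -colE [col x v]mx11_scalar mul_scalar_mx.
  by rewrite mxE.
have yx : y 0 x = 0 by rewrite /y mxE u'x !mxE !eqxx subrr.
have KK : K *m K = 0 by rewrite {1}/K -mulmxA ve yx scale0r mulmx0.
pose h := 1%:M + K; pose h' := 1%:M - K.
have hh' : h *m h' = 1%:M.
  by rewrite /h mulmxDl mul1mx /h' mulmxBr mulmx1 KK subr0 subrK.
have eE j : e *m blkE j = (i == j)%:R *: e.
  apply/rowP => z; rewrite blkE_row !mxE eqxx /=.
  by have [->|] := eqVneq z x; rewrite /= ?mulr1 ?mul1r // mulr0 mul0r.
have u'E j : u' *m blkE j = (i == j)%:R *: u'.
  apply/rowP => z; rewrite blkE_row [RHS]mxE mxE blkE_row.
  have [<-|ne] := eqVneq i j.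
    by case: (blk z == i); rewrite ?mul1r ?mulr1 ?mulr0.
  have [->|] := eqVneq (blk z) i; last by rewrite !mulr0 mul0r.
  by rewrite (negPf ne) mulr0 mul0r.
have yE j : y *m blkE j = (i == j)%:R *: y.
  by rewrite /y mulmxBl u'E eE scalerBr.
have EK j : K *m blkE j = blkE j *m K.
  rewrite /K -mulmxA yE mulmxA -[blkE j]tr_diag_mx -trmx_mul eE.
  by rewrite [(_ *: e)^T]linearZ /= -scalemxAl -scalemxAr.
have uh : h *m H \in unitmx by rewrite unitmx_mul Hu andbT; case/mulmx1_unit: hh'.
have ih : invmx (h *m H) = invmx H *m h'.
  rewrite -[RHS]mul1mx -(mulVmx uh) -!mulmxA (mulmxA H) mulmxV // mul1mx.
  by rewrite hh' mulmx1.
have sh' v : supp_in S v -> v *m h' = v.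
  by move=> Sv; rewrite /h' mulmxBr mulmx1 ve Sv // scale0r subr0.
have T'E a : h *m H *m t a *m invmx (h *m H) = h *m T a *m h'.
  by rewrite ih /T !mulmxA.
have hrow z : row z h = delta_mx 0 z + (z == x)%:R *: y.
  rewrite rowE /h mulmxDr mulmx1 ve mxE eqxx /=; congr (_ + _ *: _).
  by rewrite eq_sym.
exists (x |: S)%SET, (h *m H), (fun z => if z == x then (\max_(s in S) w s).+1 else w z).
split=> //.
- by rewrite finset.cardsU1 xS cS.
- by move=> j; rewrite -mulmxA HE !mulmxA; congr (_ *m _);
    rewrite /h mulmxDl mulmxDr mul1mx mulmx1 EK.
move=> a z z'; rewrite finset.in_setU1 T'E.
have -> : (h *m T a *m h') z z' = (row z h *m T a *m h') 0 z'.
  by rewrite -!row_mul [RHS]mxE.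
rewrite hrow; have [->|zx] := eqVneq z x => /= [_|zS].
  rewrite scale1r /y addrC subrK sh' // => ne.
  have z'S : z' \in S by apply: contraNT ne => z'S; rewrite u'T.
  have z'x : z' != x by apply: contraNneq xS => <-.
  by rewrite finset.in_setU1 z'S orbT (negPf z'x) ltnS leq_bigmax_cond.
have Sz : supp_in S (delta_mx 0 z *m T a).
  by apply: ST => z'' z''S; rewrite mxE eqxx /=; case: eqP z''S => // ->; rewrite zS.
rewrite scale0r addr0 sh' // -rowE mxE => /(HT _ _ _ zS)/andP[z'S lt].
have z'x : z' != x by apply: contraNneq xS => <-.
by rewrite finset.in_setU1 z'S orbT (negPf z'x).
Qed.

End Triangular.

End MatrixLemmas.

Record quiver := Quiver {
  vertex : finType;
  arrow : finType;
  src : arrow -> vertex;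
  tgt : arrow -> vertex
}.

Section Quiver.
Variable Q : quiver.

Definition dimvec := {ffun vertex Q -> nat}.
Implicit Types d e : dimvec.

Definition total_dim d : nat := (\sum_i d i)%N.

Definition euler (x y : vertex Q -> int) : int :=
  \sum_i x i * y i - \sum_a x (src a) * y (tgt a).

(* The dimension vectors e <= d. *)
Definition subdim d := {dffun forall i : vertex Q, 'I_(d i).+1}.

Definition dimvec_of d (e : subdim d) : dimvec := [ffun i => val (e i)].

(* This is nonnegative for e <= d, by [recursion_expE]. *)
Definition recursion_exp d e : int :=
  \sum_i ('C(d i, 2)%:Z - 'C(e i, 2)%:Z)
  - euler (fun i => (e i)%:Z) (fun i => (d i)%:Z - (e i)%:Z).

Lemma recursion_expE d e : (forall i, e i <= d i)%N ->
  recursion_exp d e =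
    (\sum_i 'C(d i - e i, 2) + \sum_a e (src a) * (d (tgt a) - e (tgt a)))%N%:Z.
Proof.
move=> le_ed; rewrite /recursion_exp /euler opprB addrA addrAC -sumrB.
rewrite PoszD !(big_morph Posz PoszD (erefl _)); congr (_ + _).
  apply: eq_bigr => i _.
  have [c ->] : exists c, d i = (e i + c)%N by exists (d i - e i)%N; rewrite subnKC.
  move: (e i : nat) => n; rewrite addKn.
  suff -> : ('C(n + c, 2) = 'C(n, 2) + 'C(c, 2) + n * c)%N.
    by rewrite !PoszD PoszM; ring.
  elim: c => [|c IHc]; first by rewrite addn0 bin0n muln0 !addn0.
  by rewrite addnS !binS IHc !bin1; lia.
by apply: eq_bigr => a _; rewrite PoszM subzn.
Qed.

Definition qbinom_dim d e : {poly int} := \prod_i qbinom (d i) (e i).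

Section Nullcone.
Variables (k : numClosedFieldType) (d : dimvec).

(* R_d is the affine space whose coordinates are the entries of the matrices of
   the arrows; it is identified with k^(rep_dim) by enumerating these. *)
Definition rep_coord : finType :=
  {a : arrow Q & ('I_(d (tgt a)) * 'I_(d (src a)))%type}.

Definition rep_dim : nat := #|{: rep_coord}|.

Definition rep_mx (V : seq k) (a : arrow Q) : 'M[k]_(d (tgt a), d (src a)) :=
  \matrix_(p, q) V`_(enum_rank (Tagged _ (p, q) : rep_coord)).

Definition rep_orbit (V : seq k) : set (seq k) :=
  [set W | affine_points rep_dim W /\
    exists g : forall i, 'M[k]_(d i), (forall i, g i \in unitmx) /\
      forall a, rep_mx W a = g (tgt a) *m rep_mx V a *m invmx (g (src a))].

(* Zariski closure; for orbits it agrees with the Euclidean closure. *)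
Definition zclosure n (A : set (seq k)) : set (seq k) :=
  [set x | forall Z, isclosed (affine k n) Z -> A `<=` Z -> Z x].

Definition nullcone : set (seq k) :=
  [set V | affine_points rep_dim V /\
           zclosure rep_dim (rep_orbit V) (nseq rep_dim 0)].


(* The rest of this section proves that the nullcone is the zero locus of the
   traces of all nonempty products of arrows, and thus closed. *)
Let T : finType := {i : vertex Q & 'I_(d i)}.
Let N := #|{: T}|.
Let rk i (p : 'I_(d i)) : 'I_N := enum_rank (Tagged _ p : T).
Let blk (x : 'I_N) : vertex Q := tag (enum_val x).
Let P i : 'M[k]_(d i, N) := \matrix_(p, x) (x == rk p)%:R.

Let rk_inj i : injective (@rk i).
Proof. by move=> p q /enum_rank_inj /eqP; rewrite eq_Tagged => /eqP. Qed.

Let blk_rk i (p : 'I_(d i)) : blk (rk p) = i.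
Proof. by rewrite /blk enum_rankK. Qed.

Let rk_blk x i : blk x = i -> exists p : 'I_(d i), x = rk p.
Proof.
move=> <-; exists (tagged (enum_val x)).
by rewrite /rk -[Tagged _ _]/(Tagged _ (tagged _)) taggedK enum_valK.
Qed.

Let mulP i n (M : 'M_(N, n)) p y : (P i *m M) p y = M (rk p) y.
Proof.
rewrite mxE (bigD1 (rk p)) //= mxE eqxx mul1r big1 ?addr0 // => x ne.
by rewrite mxE (negPf ne) mul0r.
Qed.

Let mulPt i n (M : 'M_(n, N)) x p : (M *m (P i)^T) x p = M x (rk p).
Proof.
rewrite mxE (bigD1 (rk p)) //= !mxE eqxx mulr1 big1 ?addr0 // => y ne.
by rewrite !mxE (negPf ne) mulr0.
Qed.

Let PPt i : P i *m (P i)^T = 1%:M.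
Proof.
apply/matrixP => p q; rewrite mulPt !mxE.
by rewrite (inj_eq (@rk_inj i)) eq_sym.
Qed.

Let PPt0 i j : i != j -> P i *m (P j)^T = 0.
Proof.
move=> ne; apply/matrixP => p q; rewrite mulPt !mxE.
by case: eqP => // /(congr1 blk); rewrite !blk_rk => ij; rewrite ij eqxx in ne.
Qed.

Let PtP i : (P i)^T *m P i = blkE k blk i.
Proof.
apply/matrixP => x y; rewrite !mxE.
have [bi|ne] := eqVneq (blk x) i.
  have [p ->] := rk_blk bi; rewrite (bigD1 p) //= big1 ?addr0 => [|q ne].
    by rewrite !mxE eqxx mul1r eq_sym; case: eqP => //=.
  by rewrite !mxE (inj_eq (@rk_inj i)) eq_sym (negPf ne) mul0r.
rewrite mul0rn big1 // => p _; rewrite !mxE.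
case: eqP => [xp|_]; last by rewrite mul0r.
by rewrite xp blk_rk eqxx in ne.
Qed.

Let tot (V : seq k) a : 'M[k]_N := (P (tgt a))^T *m rep_mx V a *m P (src a).

Let block (g : forall i, 'M[k]_(d i)) : 'M[k]_N := \sum_i (P i)^T *m g i *m P i.

Let mulP_block g j : P j *m block g = g j *m P j.
Proof.
rewrite /block mulmx_sumr (bigD1 j) //= !mulmxA PPt mul1mx big1 ?addr0 //.
by move=> i ne; rewrite !mulmxA PPt0 ?mul0mx // eq_sym.
Qed.

Let block_mulPt g j : block g *m (P j)^T = (P j)^T *m g j.
Proof.
rewrite /block mulmx_suml (bigD1 j) //= -mulmxA PPt mulmx1 big1 ?addr0 //.
by move=> i ne; rewrite -mulmxA PPt0 ?mulmx0.
Qed.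

Let blockV g : (forall i, g i \in unitmx) ->
  block g *m block (fun i => invmx (g i)) = 1%:M.
Proof.
move=> gu; rewrite {2}/block mulmx_sumr.
transitivity (\sum_i blkE k blk i).
  by apply: eq_bigr => i _; rewrite !mulmxA block_mulPt mulmxK // PtP.
apply/matrixP => x y; rewrite summxE (bigD1 (blk x)) //= !mxE eqxx.
rewrite big1 ?addr0 // => i ne; rewrite !mxE eq_sym (negPf ne).
by case: eqP.
Qed.

Let polyfun_entries m n (M : seq k -> 'M[k]_(m, n)) :=
  forall p q, polyfun rep_dim (fun V => M V p q).

Let polyfun_sum (I : Type) (s : seq I) (F : I -> seq k -> k) :
  (forall i, polyfun rep_dim (F i)) ->
  polyfun rep_dim (fun V => \sum_(i <- s) F i V).
Proof.
move=> pF; elim: s => [|i s IH].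
  rewrite (_ : (fun _ => _) = (fun=> 0)); first exact: polyfun_cst.
  by apply/funext => V; rewrite big_nil.
rewrite (_ : (fun _ => _) = (fun V => F i V + \sum_(j <- s) F j V)).
  exact: polyfunD.
by apply/funext => V; rewrite big_cons.
Qed.

Let polyfun_mulmx m n l (M : seq k -> 'M[k]_(m, n)) (M' : seq k -> 'M[k]_(n, l)) :
  polyfun_entries M -> polyfun_entries M' ->
  polyfun_entries (fun V => M V *m M' V).
Proof.
move=> pM pM' p q; rewrite (_ : (fun _ => _) =
    (fun V => \sum_i M V p i * M' V i q)).
  by apply: polyfun_sum => i; apply: polyfunM.
by apply/funext => V; rewrite mxE.
Qed.

Let polyfun_const m n (M : 'M[k]_(m, n)) : polyfun_entries (fun=> M).
Proof. by move=> p q; apply: polyfun_cst. Qed.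

Let polyfun_word w : polyfun_entries (fun V => word (tot V) w).
Proof.
elim: w => [|a w IH] /=; first exact: polyfun_const.
apply: polyfun_mulmx => //; apply: polyfun_mulmx; last exact: polyfun_const.
apply: polyfun_mulmx; first exact: polyfun_const.
move=> p q; rewrite (_ : (fun _ => _) =
    (fun V => V`_(enum_rank (Tagged _ (p, q) : rep_coord)))).
  exact: polyfun_coord.
by apply/funext => V; rewrite mxE.
Qed.

Let polyfun_tr w : polyfun rep_dim (fun V => \tr (word (tot V) w)).
Proof. by apply: polyfun_sum => i; apply: polyfun_word. Qed.

Let tot_orbit V W w : rep_orbit V W ->
  \tr (word (tot W) w) = \tr (word (tot V) w).
Proof.
move=> [_ [g [gu gW]]].
have uG := blockV gu; have [Gu _] := mulmx1_unit uG.
have iG : invmx (block g) = block (fun i => invmx (g i)).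
  by rewrite -[RHS]mul1mx -(mulVmx Gu) -mulmxA uG mulmx1.
have -> : word (tot W) w = block g *m word (tot V) w *m invmx (block g).
  rewrite -word_conj //; congr (word _ w); apply/funext => a.
  rewrite iG /tot gW !mulmxA block_mulPt -!mulmxA; congr (_ *m (_ *m (_ *m _))).
  by rewrite mulP_block.
by rewrite mxtrace_mulC mulmxA mulVmx // mul1mx.
Qed.

Let rep_mx0 a : rep_mx (nseq rep_dim 0) a = 0.
Proof. by apply/matrixP => p q; rewrite !mxE nth_nseq if_same. Qed.

Let nullcone_tr V : nullcone V -> tr_nil (tot V).
Proof.
move=> [_ V0] w w0.
pose f (W : seq k) := \tr (word (tot W) w) + - \tr (word (tot V) w).
have fp : polyfun rep_dim f by apply: polyfunD; [exact: polyfun_tr | exact: polyfun_cst].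
have [||_ H] := V0 (zero_locus rep_dim [set f]).
- by apply: zero_locus_closed => _ ->.
- by move=> W oW; split; [case: oW | move=> _ ->; rewrite /f (tot_orbit _ oW) subrr].
have /eqP := H f erefl; rewrite /f subr_eq0 => /eqP <-.
case: w w0 {f fp H} => // a w _ /=.
by rewrite /tot rep_mx0 mulmx0 !mul0mx mxtrace0.
Qed.

Let tr_nullcone V : affine_points rep_dim V -> tr_nil (tot V) -> nullcone V.
Proof.
move=> sV tn; split=> //.
have tE a j : blkE k blk j *m tot V a = (j == tgt a)%:R *: tot V a.
  rewrite -PtP /tot !mulmxA; have [->|ne] := eqVneq j (tgt a).
    by rewrite -(mulmxA _ (P _)) PPt mulmx1 scale1r.
  by rewrite -(mulmxA _ (P _)) PPt0 // mulmx0 !mul0mx scale0r.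
have [H [w [Hu HE HT]]] := strict_triangular tn tE.
pose S a := H *m tot V a *m invmx H.
pose cf (i : 'I_rep_dim) : k := let c := enum_val i in
  S (tag c) (rk (tagged c).1) (rk (tagged c).2).
pose ex (i : 'I_rep_dim) : nat := let c := enum_val i in
  (w (rk (tagged c).1) - w (rk (tagged c).2))%N.
pose phi (s : k) : seq k := [tuple cf i * s ^+ ex i | i < rep_dim].
have phiE s (i : 'I_rep_dim) : (phi s)`_i = cf i * s ^+ ex i.
  by rewrite -tnth_nth tnth_mktuple.
have phi0 : phi 0 = nseq rep_dim 0.
  apply: (@eq_from_nth _ 0); first by rewrite size_tuple size_nseq.
  rewrite size_tuple => i lti; rewrite (phiE 0 (Ordinal lti)) nth_nseq lti.
  rewrite expr0n; case: eqP => [e0|_]; last by rewrite mulr0.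
  rewrite mulr1; apply/eqP; apply: contraTT (erefl true) => /HT.
  by rewrite -subn_gt0 -[(_ - _)%N]/(ex (Ordinal lti)) e0.
have phi_orbit s : s != 0 -> rep_orbit V (phi s).
  move=> s0; split; first exact: size_tuple.
  pose D : 'M[k]_N := diag_mx (\row_x s ^+ w x).
  pose D' : 'M[k]_N := diag_mx (\row_x (s ^+ w x)^-1).
  have DD : D *m D' = 1%:M.
    apply/matrixP => x y; rewrite mul_diag_mx !mxE.
    by case: eqP => [->|]; rewrite ?mulr0 // mulr1n mulfV // expf_neq0.
  have DE j : D *m blkE k blk j = blkE k blk j *m D.
    by rewrite /D /blkE diag_mxC.
  have dE (M : 'M[k]_N) x y :
      (D *m M *m D') x y = s ^+ w x * M x y * (s ^+ w y)^-1.
    by rewrite mul_mx_diag mul_diag_mx !mxE.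
  pose g i := P i *m (D *m H) *m (P i)^T.
  pose g' i := P i *m (invmx H *m D') *m (P i)^T.
  have gg i : g i *m g' i = 1%:M.
    rewrite /g /g' !mulmxA -(mulmxA _ (P i)^T) PtP -(mulmxA _ H) HE.
    rewrite !mulmxA mulmxK // -(mulmxA _ D) DE !mulmxA -(mulmxA _ D) DD mulmx1.
    by rewrite -PtP !mulmxA PPt mul1mx PPt.
  exists g; split=> [i|a]; first by case/mulmx1_unit: (gg i).
  have gu i : g i \in unitmx by case/mulmx1_unit: (gg i).
  have -> : invmx (g (src a)) = g' (src a).
    by rewrite -[RHS]mul1mx -(mulVmx (gu _)) -mulmxA gg mulmx1.
  transitivity (P (tgt a) *m (D *m S a *m D') *m (P (src a))^T); last first.
    by rewrite /g /g' /S /tot !mulmxA.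
  apply/matrixP => p q; rewrite mulPt mulP mxE phiE /cf /ex enum_rankK /=.
  rewrite dE; set x := rk p; set y := rk q; set z := S a x y.
  have [->|/HT lt_yx] := eqVneq z 0; first by rewrite mulr0 !mul0r.
  by rewrite -mulrA mulrCA expfB // ltnW.
move=> Z [_ Zo] oZ; apply: contrapT => nZ.
have phin s : affine_points rep_dim (phi s) by exact: size_tuple.
have [|h [hp h0 hZ]] := zopenP Zo (x := phi 0).
  by split; [exact: phin | rewrite phi0].
have [p pE] : exists p : {poly k}, forall s, h (phi s) = p.[s].
  elim: hp => [c|i|f1 f2 _ [p1 E1] _ [p2 E2]|f1 f2 _ [p1 E1] _ [p2 E2]].
  - by exists c%:P => s; rewrite hornerC.
  - by exists (cf i *: 'X^(ex i)) => s; rewrite phiE !hornerE.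
  - by exists (p1 + p2) => s; rewrite E1 E2 hornerD.
  - by exists (p1 * p2) => s; rewrite E1 E2 hornerM.
have p0 : p != 0 by apply: contraNneq h0 => p0; rewrite pE p0 horner0.
have : exists2 s, s != 0 & p.[s] != 0.
  have Xp0 : 'X * p != 0 by rewrite mulf_neq0 // polyX_eq0.
  pose rs := [seq i%:R : k | i <- iota 0 (size ('X * p))].
  have urs : uniq rs.
    by rewrite map_inj_uniq ?iota_uniq // => i j /eqP; rewrite eqr_nat => /eqP.
  have : ~~ all (root ('X * p)) rs.
    apply/negP => ars; have := max_poly_roots Xp0 ars urs.
    by rewrite size_map size_iota ltnn.
  case/allPn => s _; rewrite /root hornerM hornerX mulf_eq0 negb_or.
  by case/andP; exists s.
move=> [s s0 ps].
have [] := hZ (phi s) (phin s); first by rewrite pE.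
by move=> _; apply; apply/oZ/phi_orbit.
Qed.

Lemma nullcone_closed : isclosed (affine k rep_dim) nullcone.
Proof.
suff -> : nullcone = zero_locus rep_dim
    [set f | exists2 w, w <> [::] & f = fun V => \tr (word (tot V) w)].
  by apply: zero_locus_closed => _ [w _ ->]; apply: polyfun_tr.
apply/seteqP; split=> V.
  move=> NV; split; first by case: NV.
  by move=> _ [w w0 ->]; apply: nullcone_tr NV _ w0.
move=> [sV H]; apply: tr_nullcone => // w w0.
by apply: (H (fun V => \tr (word (tot V) w))); exists w.
Qed.

Definition nullcone_variety : variety k := closed_subvariety nullcone_closed.

End Nullcone.
End Quiver.

(* Main.v *)
(* Over a finite field the identity counts pairs (V, K), with V in N_d and K a
   graded subspace of the common kernel (the socle) of the arrows of V, with sign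
   (-1)^dim K and weight q^(sum_i binom(dim K_i, 2)): for given K the V killing K
   form N_(d - dim K) times an affine space, while for given V the weighted signed
   sum over all K in soc V vanishes, as soc V <> 0 for nilpotent V and d <> 0.

   In K_0 one cannot divide, so each K is replaced by non-reduced echelon bases:
   for a set T of basis vectors consider pairs of V in N_d and a family of vectors
   e_y + (combination of the e_x, x < y, in the same block) in soc V, for y in T.
   The weights q^binom(dim K_i, 2) are then accounted for by the q-binomial
   theorem. Conjugation with the unitriangular matrix of the family makes V kill
   the e_y, which gives the class of the space of pairs as [N_(d - |T|)] times a
   power of L. On the other hand N_d is stratified by the vanishing of minors so
   that on each stratum the least leading term m of a vector in soc V is constant;
   this vector is then unique and regular in V, so that adding m to T or removing
   it does not change the class over the stratum, and the signs cancel. *)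

Require Import Defs.
From HB Require Import structures.
From mathcomp Require Import all_boot all_order all_algebra complex.
From mathcomp Require Import boolp classical_sets reals.
From mathcomp Require Import ring.

Set Implicit Arguments.
Unset Strict Implicit.
Unset Printing Implicit Defensive.
Import Order.TTheory GRing.Theory Num.Theory.
Local Open Scope classical_set_scope.
Local Open Scope ring_scope.

(** * Regular maps to subspaces of affine spaces *)

Section RegularMaps.
Variable k : closedFieldType.
Implicit Types (X Y : funspace k) (A B U V : set (seq k)).

Lemma regular_subspaceE X A U f : regular (subspace X A) U f =
  (forall x, U x -> exists V g, [/\ isopen X V, V x, regular X V g
     & forall y, (V `&` U) y -> f y = g y]).
Proof. by []. Qed.

Lemma regular_polyfun X U n (phi : seq k -> seq k) f : isopen X U ->
  (forall i : 'I_n, regular X U (fun x => (phi x)`_i)) ->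
  polyfun n f -> regular X U (f \o phi).
Proof.
move=> Uo rphi; elim=> [c|i|g h _ IHg _ IHh|g h _ IHg _ IHh].
- exact: regular_cst.
- exact: rphi.
- exact: (regularD Uo IHg IHh).
- exact: (regularM Uo IHg IHh).
Qed.

(** Preimages of open sets are unions of nonvanishing loci of polynomials in the coordinates of
    [phi], and regular functions pull back locally to quotients of such polynomials. *)
Lemma regular_map_to_affine X n B (phi : seq k -> seq k) :
  (forall x, points X x -> size (phi x) = n /\ B (phi x)) ->
  (forall i : 'I_n, regular X (points X) (fun x => (phi x)`_i)) ->
  regular_map X (subspace (affine k n) B) phi.
Proof.
move=> phiB rphi; have Xo := open_points X.
have rp f : polyfun n f -> regular X (points X) (f \o phi).
  exact: regular_polyfun.
have op V : zopen n V -> isopen X (points X `&` phi @^-1` V).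
  move=> Vo.
  have -> : points X `&` phi @^-1` V = \bigcup_(O in [set O | exists h,
      [/\ polyfun n h, forall y, affine_points n y -> h y != 0 -> V y
        & O = points X `&` [set x | (h \o phi) x != 0]]]) O.
    apply/seteqP; split=> x.
      move=> [Xx Vx]; have [h [ph hx hV]] := zopenP Vo Vx.
      by exists (points X `&` [set x | (h \o phi) x != 0]) => //; exists h.
    move=> [_ [h [ph hV ->]] [Xx hx]]; split=> //; apply: hV => //.
    by case: (phiB x Xx).
  by apply: open_bigcup => _ [h [ph _ ->]]; apply/regular_neq0/rp.
have opB V : zopen n V -> points X `&` phi @^-1` (V `&` B) = points X `&` phi @^-1` V.
  move=> Vo; apply/seteqP; split=> x [Xx].
    by move=> [Vx Bx].
  by move=> Vx; split=> //; split=> //; case: (phiB x Xx).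
split=> [x Xx|_ [V Vo ->]|_ f [V Vo ->] Vf].
- by have [sx Bx] := phiB x Xx.
- by rewrite opB //; apply: op.
rewrite opB //; apply: regular_glue; first exact: op.
move=> x [Xx Vx]; have [_ Bx] := phiB x Xx.
have [W [g [Wo Wx Wg fg]]] := Vf (phi x) (conj Vx Bx).
have [W' [p [q [[W'o W'x] W'W pp pq gE]]]] := Wg (phi x) Wx.
have W'Vo : zopen n (W' `&` V) by apply: zopenI.
pose O := points X `&` phi @^-1` (W' `&` V).
have Oo : isopen X O by exact: op.
have OX : O `<=` points X by move=> y [].
have rq : regular X O (q \o phi) by apply: regular_res (rp _ pq).
(* The denominator vanishes nowhere on [O], so its inverse is regular on [O] itself. *)
have Oq : O `&` [set x | (q \o phi) x != 0] = O.
  by apply/seteqP; split=> y; [case|move=> Oy; split=> //; case: Oy => _ [/gE[]]].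
exists O; split=> //; first by move=> y [Xy [W'y Vy]].
apply: (@regular_ext _ _ _ (fun x => (p \o phi) x * ((q \o phi) x)^-1)).
  move=> y [Xy [W'y Vy]] /=; have [_ By] := phiB y Xy.
  by rewrite fg ?(gE _ W'y).2 //; split=> //; apply: W'W.
apply: regularM => //; first by apply: regular_res (rp _ pp).
by have := regularV Oo rq; rewrite Oq.
Qed.

Lemma regular_map_coord X n B phi (i : 'I_n) :
  regular_map X (subspace (affine k n) B) phi ->
  regular X (points X) (fun x => (phi x)`_i).
Proof.
move=> rphi; have [m _ r] := regular_map_comp rphi (regular_map_subspace _ _).
have E : points X = points X `&` (id \o phi) @^-1` affine_points n.
  by apply/seteqP; split=> [y Yy|y []//]; split=> //; apply: m.
have Ao := open_points (affine k n).
rewrite {1}E; apply: (r _ (fun x => x`_i)) => //.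
by apply: polyfun_regular => //; apply: polyfun_coord.
Qed.

Lemma regular_frac n A p q f : polyfun n p -> polyfun n q ->
  (forall x, size x = n -> A x -> q x != 0 /\ f x = p x / q x) ->
  regular (subspace (affine k n) A) (points (subspace (affine k n) A)) f.
Proof.
move=> pp pq fE; have Ao := open_points (affine k n).
have Vo := zopen_neq0 Ao pq; rewrite regular_subspaceE => x [sx Ax]; have [qx _] := fE x sx Ax.
exists (affine_points n `&` [set x | q x != 0]), (fun x => p x / q x).
split=> //.
  move=> y Uy; exists (affine_points n `&` [set x | q x != 0]), p, q.
  by split=> // z [_ qz].
by move=> y [_ [sy Ay]]; case: (fE y sy Ay).
Qed.

Lemma regular_map_frac n m A B (phi : seq k -> seq k) :
  (forall x, size x = n -> A x -> size (phi x) = m /\ B (phi x)) ->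
  (forall i : 'I_m, exists p q, [/\ polyfun n p, polyfun n q &
     forall x, size x = n -> A x -> q x != 0 /\ (phi x)`_i = p x / q x]) ->
  regular_map (subspace (affine k n) A) (subspace (affine k m) B) phi.
Proof.
move=> AB fr; apply: regular_map_to_affine => [x [sx Ax]|i]; first exact: AB.
by have [p [q [pp pq E]]] := fr i; apply: regular_frac pp pq E.
Qed.

Lemma isomorphic_sym X Y : isomorphic X Y -> isomorphic Y X.
Proof. by move=> [h [h' [? ? ? ?]]]; exists h', h; split. Qed.

(** The identity is an isomorphism: the open sets agree, and a local extension to [A] followed by
    one to [X] is a local extension to [X]. *)
Lemma subspace_subspace X A B :
  isomorphic (subspace (subspace X A) B) (subspace X (A `&` B)).
Proof.
have P1 : points (subspace (subspace X A) B) = points (subspace X (A `&` B)).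
  by rewrite /= setIA.
have oE U : isopen (subspace (subspace X A) B) U <-> isopen (subspace X (A `&` B)) U.
  split=> [[_ [V Vo ->] ->]|[V Vo ->]].
    by exists V; rewrite ?setIA.
  by exists (V `&` A); [exists V|rewrite setIA].
have oI U : isopen (subspace (subspace X A) B) U ->
    points (subspace X (A `&` B)) `&` U = U.
  by move=> /open_sub UX; rewrite setIC setIidl // -P1.
exists id, id; split=> //.
- split=> [x|V Vo|V f Vo Vf].
  + by rewrite P1.
  + by rewrite P1 oI; apply/oE.
  + rewrite P1 oI; last exact/oE.
    rewrite regular_subspaceE => x Vx.
    have [W [g [Wo Wx Wg fg]]] := Vf x Vx; have [V' _ VE] := Vo.
    have Ax : A x by move: Vx; rewrite VE => -[_ []].
    exists (W `&` A), g; split=> //; first by exists W.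
      by move=> y [Wy Ay]; exists W, g; split=> // z [Wz _].
    by move=> y [[Wy Ay] Vy]; apply: fg.
- split=> [x|V Vo|V f Vo Vf].
  + by rewrite P1.
  + by rewrite oI //; apply/oE.
  + rewrite oI // !regular_subspaceE => x Vx; have [W [g [Wo Wx Wg fg]]] := Vf x Vx.
    have [W' [g' [W'o W'x W'g gg']]] := Wg x Wx.
    have [W0 W0o WE] := Wo.
    (* Shrinking to [W0] keeps the points inside [W], where [g] agrees with [f]. *)
    exists (W' `&` W0), g'; split=> //; first exact: openI.
    * by split=> //; move: Wx; rewrite WE => -[].
    * by apply: regular_res W'g => //; apply: openI.
    * move=> y [[W'y W0y] Vy].
      have Ay : A y by have [_ [V' _ ->] VE] := Vo; move: Vy; rewrite VE => -[[]].
      have Wy : W y by rewrite WE.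
      by rewrite /= fg // gg'.
Qed.

End RegularMaps.

(** * Polynomial and rational functions on k^I *)

Section PolynomialFunctions.
Variable k : closedFieldType.
Implicit Types I J : finType.

(* Polynomial functions on [k^I]; unlike [polyfun], the coordinates are indexed
   by an arbitrary finite type. *)
Inductive pol I : ((I -> k) -> k) -> Prop :=
| pol_cst (c : k) : pol (fun=> c)
| pol_coord (i : I) : pol (fun x => x i)
| polD f g : pol f -> pol g -> pol (fun x => f x + g x)
| polM f g : pol f -> pol g -> pol (fun x => f x * g x).

Lemma polN I (f : (I -> k) -> k) : pol f -> pol (fun x => - f x).
Proof.
move=> pf; have := polM (pol_cst I (-1)) pf.
by under eq_fun do rewrite mulN1r.
Qed.

Lemma polB I (f g : (I -> k) -> k) :
  pol f -> pol g -> pol (fun x => f x - g x).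
Proof. by move=> pf pg; apply/polD/polN. Qed.

Lemma pol_sum I (T : Type) (r : seq T) (P : pred T) (F : T -> (I -> k) -> k) :
  (forall t, pol (F t)) -> pol (fun x => \sum_(t <- r | P t) F t x).
Proof.
move=> pF; elim: r => [|t r IH].
  by under eq_fun do rewrite big_nil; apply: pol_cst.
under eq_fun do rewrite big_cons; case: (P t) => //.
exact: polD.
Qed.

Lemma pol_prod I (T : Type) (r : seq T) (P : pred T) (F : T -> (I -> k) -> k) :
  (forall t, pol (F t)) -> pol (fun x => \prod_(t <- r | P t) F t x).
Proof.
move=> pF; elim: r => [|t r IH].
  by under eq_fun do rewrite big_nil; apply: pol_cst.
under eq_fun do rewrite big_cons; case: (P t) => //.
exact: polM.
Qed.

Lemma pol_comp I J (f : (J -> k) -> k) (phi : (I -> k) -> J -> k) :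
  pol f -> (forall j, pol (fun x => phi x j)) -> pol (fun x => f (phi x)).
Proof.
move=> pf pphi; elim: pf => [c|j|g h _ pg _ ph|g h _ pg _ ph].
- exact: pol_cst.
- exact: pphi.
- exact: polD.
- exact: polM.
Qed.

Definition polmx I m n (M : (I -> k) -> 'M[k]_(m, n)) :=
  forall i j, pol (fun x => M x i j).

Lemma polmx_mul I m n p (M : (I -> k) -> 'M[k]_(m, n)) (M' : (I -> k) -> 'M_(n, p)) :
  polmx M -> polmx M' -> polmx (fun x => M x *m M' x).
Proof.
move=> pM pM' i j; under eq_fun do rewrite mxE.
by apply: pol_sum => l; apply: polM.
Qed.

Lemma polmx_cst I m n (M : 'M[k]_(m, n)) : polmx (fun _ : I -> k => M).
Proof. by move=> i j; apply: pol_cst. Qed.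

Lemma polmx_add I m n (M M' : (I -> k) -> 'M[k]_(m, n)) :
  polmx M -> polmx M' -> polmx (fun x => M x + M' x).
Proof. by move=> pM pM' i j; under eq_fun do rewrite mxE; apply: polD. Qed.

Lemma polmx_tr I n (M : (I -> k) -> 'M[k]_n) : polmx M -> pol (fun x => \tr (M x)).
Proof. by move=> pM; apply: pol_sum => i; apply: pM. Qed.

Lemma polmx_det I n (M : (I -> k) -> 'M[k]_n) : polmx M -> pol (fun x => \det (M x)).
Proof.
move=> pM; apply: pol_sum => s; apply: polM; first exact: pol_cst.
by apply: pol_prod => i; apply: pM.
Qed.

Lemma polmx_adj I n (M : (I -> k) -> 'M[k]_n) : polmx M -> polmx (fun x => \adj (M x)).
Proof.
move=> pM i j; under eq_fun do rewrite mxE; apply: polM; first exact: pol_cst.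
by apply: polmx_det => p q; under eq_fun do rewrite !mxE; apply: pM.
Qed.

(** A single fraction on all of [A], instead of local ones: matrix products, and inverses through
    determinants, stay within this class. *)
Definition rat I (A : set (I -> k)) f := exists p q, [/\ pol p, pol q &
  forall x, A x -> q x != 0 /\ f x = p x / q x].

Lemma rat_pol I (A : set (I -> k)) f : pol f -> rat A f.
Proof.
move=> pf; exists f, (fun=> 1); split=> // [|x _]; first exact: pol_cst.
by rewrite oner_neq0 divr1.
Qed.

Lemma rat_ext I (A : set (I -> k)) f g :
  (forall x, A x -> f x = g x) -> rat A f -> rat A g.
Proof.
move=> fg [p [q [pp pq E]]]; exists p, q; split=> // x Ax.
by rewrite -fg //; apply: E.
Qed.

Lemma ratD I (A : set (I -> k)) f g : rat A f -> rat A g -> rat A (fun x => f x + g x).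
Proof.
move=> [p [q [pp pq E]]] [p' [q' [pp' pq' E']]].
exists (fun x => p x * q' x + p' x * q x), (fun x => q x * q' x); split.
- by apply: polD; apply: polM.
- exact: polM.
- move=> x Ax; have [qx ->] := E x Ax; have [qx' ->] := E' x Ax.
  by rewrite mulf_neq0 // addf_div.
Qed.

Lemma ratM I (A : set (I -> k)) f g : rat A f -> rat A g -> rat A (fun x => f x * g x).
Proof.
move=> [p [q [pp pq E]]] [p' [q' [pp' pq' E']]].
exists (fun x => p x * p' x), (fun x => q x * q' x); split; try exact: polM.
move=> x Ax; have [qx ->] := E x Ax; have [qx' ->] := E' x Ax.
by rewrite mulf_neq0 // mulf_div.
Qed.

Lemma ratV I (A : set (I -> k)) f : pol f -> (forall x, A x -> f x != 0) ->
  rat A (fun x => (f x)^-1).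
Proof.
move=> pf fA; exists (fun=> 1), f; split=> // [|x Ax]; first exact: pol_cst.
by rewrite fA // div1r.
Qed.

Lemma rat_sum I (A : set (I -> k)) (T : Type) (r : seq T) (F : T -> (I -> k) -> k) :
  (forall t, rat A (F t)) -> rat A (fun x => \sum_(t <- r) F t x).
Proof.
move=> pF; elim: r => [|t r IH].
  by under eq_fun do rewrite big_nil; apply/rat_pol/pol_cst.
by under eq_fun do rewrite big_cons; apply: ratD.
Qed.

Definition ratmx I (A : set (I -> k)) m n (M : (I -> k) -> 'M[k]_(m, n)) :=
  forall i j, rat A (fun x => M x i j).

Lemma ratmx_pol I (A : set (I -> k)) m n (M : (I -> k) -> 'M[k]_(m, n)) :
  polmx M -> ratmx A M.
Proof. by move=> pM i j; apply/rat_pol/pM. Qed.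

Lemma ratmx_mul I (A : set (I -> k)) m n p (M : (I -> k) -> 'M[k]_(m, n))
    (M' : (I -> k) -> 'M_(n, p)) :
  ratmx A M -> ratmx A M' -> ratmx A (fun x => M x *m M' x).
Proof.
move=> pM pM' i j; under eq_fun do rewrite mxE.
by apply: rat_sum => l; apply: ratM.
Qed.

(** By Cramer's rule the only denominator is the determinant. *)
Lemma ratmx_inv I (A : set (I -> k)) n (M : (I -> k) -> 'M[k]_n) : polmx M ->
  (forall x, A x -> M x \in unitmx) -> ratmx A (fun x => invmx (M x)).
Proof.
move=> pM uM i j; apply: (@rat_ext _ _ (fun x => (\det (M x))^-1 * (\adj (M x)) i j)).
  by move=> x Ax; rewrite /invmx uM // [RHS]mxE.
apply: ratM; last exact/rat_pol/polmx_adj.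
by apply: ratV => [|x /uM]; [apply: polmx_det | rewrite unitmxE unitfE].
Qed.

(** A closed subset of a principal open set. Such sets are affine varieties, and cutting one by the
    vanishing of a polynomial gives two more, which is what stratifying by minors requires. *)
Definition basic I (A : set (I -> k)) := exists (S : set ((I -> k) -> k)) g,
  [/\ forall f, S f -> pol f, pol g
    & forall x, A x <-> (forall f, S f -> f x = 0) /\ g x != 0].

Lemma basic_zero I (S : set ((I -> k) -> k)) : (forall f, S f -> pol f) ->
  basic [set x | forall f, S f -> f x = 0].
Proof.
move=> pS; exists S, (fun=> 1); split=> // [|x]; first exact: pol_cst.
by split=> [Ax|[]] //; rewrite oner_neq0.
Qed.

Lemma basic_all_eq0 I (T : Type) (P : T -> Prop) (F : T -> (I -> k) -> k) :
  (forall t, pol (F t)) -> basic [set x | forall t, P t -> F t x = 0].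
Proof.
move=> pF; have [|S [g [pS pg E]]] := @basic_zero _ [set f | exists2 t, P t & f = F t].
  by move=> _ [t _ ->].
exists S, g; split=> // x; rewrite -E; split=> [Fx _ [t Pt ->]|Fx t Pt].
  exact: Fx.
by apply: Fx; exists t.
Qed.

Lemma basic_neq0 I f : pol f -> basic [set x : I -> k | f x != 0].
Proof. by move=> pf; exists set0, f; split=> // x; split=> [|[]]. Qed.

Lemma basic_eq0 I f : pol f -> basic [set x : I -> k | f x = 0].
Proof.
move=> pf; have [|S [g [pS pg E]]] := @basic_zero I [set f]; first by move=> _ ->.
exists S, g; split=> // x; rewrite -E; split=> [fx _ ->|] //.
by apply.
Qed.

Lemma basicI I (A B : set (I -> k)) : basic A -> basic B -> basic (A `&` B).
Proof.
move=> [S [g [pS pg E]]] [S' [g' [pS' pg' E']]].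
exists (S `|` S'), (fun x => g x * g' x); split=> [f [/pS|/pS']||x] //.
  exact: polM.
rewrite mulf_eq0 negb_or; split=> [[/E[Sx gx] /E'[S'x g'x]]|[H /andP[gx g'x]]].
  by rewrite gx g'x; split=> // f [/Sx|/S'x].
by split; [apply/E|apply/E']; split=> // f Sf; apply: H; [left|right].
Qed.

Lemma basic_preimage I J (A : set (J -> k)) (phi : (I -> k) -> J -> k) :
  basic A -> (forall j, pol (fun x => phi x j)) -> basic [set x | A (phi x)].
Proof.
move=> [S [g [pS pg E]]] pphi.
exists [set f | exists2 h, S h & f = fun x => h (phi x)], (fun x => g (phi x)).
split=> [_ [h /pS ph ->]||x].
- exact: pol_comp.
- exact: pol_comp.
- split=> [/E[Sx gx]|[H gx]].
    by split=> // _ [h Sh ->]; apply: Sx.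
  by apply/E; split=> // h Sh; apply: (H (fun x => h (phi x))); exists h.
Qed.

Lemma basicT I : basic [set: I -> k].
Proof.
exists set0, (fun=> 1); split=> // [|x]; first exact: pol_cst.
by split=> // _; split=> //; rewrite oner_neq0.
Qed.

Lemma basic_ext I (A B : set (I -> k)) : (forall x, A x <-> B x) -> basic A -> basic B.
Proof.
by move=> AB [S [g [pS pg E]]]; exists S, g; split=> // x; rewrite -AB.
Qed.

End PolynomialFunctions.

(** * Classes in K_0 of basic sets *)

Section MotivicClass.
Variable k : closedFieldType.
Implicit Types I J : finType.

Definition enc I (x : I -> k) : seq k := [seq x i | i <- enum I].
Definition dec I (s : seq k) (i : I) : k := s`_(enum_rank i).

Lemma size_enc I (x : I -> k) : size (enc x) = #|I|.
Proof. by rewrite size_map -cardE. Qed.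

Lemma nth_enc I (x : I -> k) (i : 'I_#|I|) : (enc x)`_i = x (enum_val i).
Proof.
rewrite (nth_map (enum_val i)); last by rewrite -cardE.
by rewrite -enum_val_nth.
Qed.

Lemma encK I : cancel (@enc I) (@dec I).
Proof. by move=> x; apply/funext => i; rewrite /dec nth_enc enum_rankK. Qed.

Lemma decK I s : size s = #|I| -> enc (@dec I s) = s.
Proof.
move=> sz; apply: (@eq_from_nth _ 0); rewrite size_enc // => i lti.
by rewrite (nth_enc _ (Ordinal lti)) /dec enum_valK.
Qed.

Lemma pol_polyfun I (f : (I -> k) -> k) : pol f -> polyfun #|I| (fun s => f (dec s)).
Proof.
elim=> [c|i|g h _ pg _ ph|g h _ pg _ ph].
- exact: polyfun_cst.
- exact: polyfun_coord.
- exact: polyfunD.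
- exact: polyfunM.
Qed.

Definition realize I (A : set (I -> k)) : set (seq k) :=
  [set s | size s = #|I| /\ A (dec s)].

Local Notation realization I A := (subspace (affine k #|I|) (@realize I A)).

Lemma isomorphic_realize I J (A : set (I -> k)) (B : set (J -> k)) phi psi :
  (forall x, A x -> B (phi x) /\ psi (phi x) = x) ->
  (forall y, B y -> A (psi y) /\ phi (psi y) = y) ->
  (forall j, rat A (fun x => phi x j)) -> (forall i, rat B (fun y => psi y i)) ->
  isomorphic (realization I A) (realization J B).
Proof.
have half I' J' (A' : set (I' -> k)) (B' : set (J' -> k)) f :
    (forall x, A' x -> B' (f x)) -> (forall j, rat A' (fun x => f x j)) ->
    regular_map (realization I' A') (realization J' B') (fun s => enc (f (dec s))).
  move=> AB rf; apply: regular_map_frac => [s sz [_ As]|j].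
    by split; [exact: size_enc | split; [exact: size_enc | rewrite encK; exact: AB]].
  have [p [q [pp pq E]]] := rf (enum_val j).
  exists (fun s => p (dec s)), (fun s => q (dec s)); split.
  - exact: pol_polyfun.
  - exact: pol_polyfun.
  - by move=> s sz [_ As]; rewrite nth_enc; apply: E.
move=> AB BA rphi rpsi.
exists (fun s => enc (phi (dec s))), (fun s => enc (psi (dec s))); split.
- by apply: half => // x /AB[].
- by apply: half => // x /BA[].
- by move=> s [sz [_ As]]; rewrite encK (AB _ As).2 decK.
- by move=> s [sz [_ Bs]]; rewrite encK (BA _ Bs).2 decK.
Qed.

Lemma realize_zero_locus I (S : set ((I -> k) -> k)) : (forall f, S f -> pol f) ->
  isclosed (affine k #|I|) (realize [set x | forall f, S f -> f x = 0]).
Proof.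
move=> pS.
suff -> : realize [set x | forall f, S f -> f x = 0] = zero_locus #|I|
    [set h | exists2 f, S f & h = fun s => f (dec s)].
  by apply: zero_locus_closed => _ [f /pS pf ->]; apply: pol_polyfun.
apply/seteqP; split=> s [sz H]; split=> //.
  by move=> _ [f Sf ->]; apply: H.
by move=> f Sf; apply: (H (fun s => f (dec s))); exists f.
Qed.

(* The locus [f = 0, g != 0] is the closed locus [f = 0, g * t = 1] in one more
   variable t. *)
Lemma basic_affine I (A : set (I -> k)) : basic A -> is_affine (realization I A).
Proof.
move=> [S [g [pS pg E]]].
pose S' : set ((option I -> k) -> k) := [set h |
  (exists2 f, S f & h = fun y => f (fun i => y (Some i))) \/
  h = fun y => g (fun i => y (Some i)) * y None - 1].
have pS' h : S' h -> pol h.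
  case=> [[f /pS pf ->]|->].
    by apply: pol_comp pf _ => i; apply: pol_coord.
  apply: polB (pol_cst _ _); apply: polM; last exact: pol_coord.
  by apply: pol_comp pg _ => i; apply: pol_coord.
exists #|{: option I}|, (realize [set y | forall h, S' h -> h y = 0]).
split; first exact: realize_zero_locus.
apply: (@isomorphic_realize _ _ _ _
  (fun x c => if c is Some i then x i else (g x)^-1) (fun y i => y (Some i))).
- move=> x /E[Sx gx]; split=> // h [[f Sf ->]|->]; first exact: Sx.
  by rewrite mulfV // subrr.
- move=> y Sy; have gy : g (fun i => y (Some i)) * y None = 1.
    by apply/eqP; rewrite -subr_eq0; apply/eqP;
      apply: (Sy (fun y => g (fun i => y (Some i)) * y None - 1)); right.
  have gy0 : g (fun i => y (Some i)) != 0.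
    by apply: contra_eq_neq gy => ->; rewrite mul0r eq_sym oner_neq0.
  split.
    apply/E; split=> // f Sf; apply: (Sy (fun y => f (fun i => y (Some i)))).
    by left; exists f.
  apply/funext => -[i|] //; apply: (mulfI gy0).
  by rewrite gy mulfV.
- case=> [i|]; first exact/rat_pol/pol_coord.
  by apply: ratV => // x /E[].
- by move=> i; apply/rat_pol/pol_coord.
Qed.

Definition basic_variety I (A : set (I -> k)) (bA : basic A) : variety k :=
  Variety (affine_has_affine_cover (basic_affine bA))
          (subspace_separated (@affine_separated k #|I|)).

(* [0] is a junk value outside basic sets. *)
Definition mu I (A : set (I -> k)) : K0 k :=
  if pselect (basic A) is left bA then K0_class (basic_variety bA) else 0.

Lemma K0_class_iso (X Y : variety k) : isomorphic X Y -> K0_class X = K0_class Y.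
Proof. by move=> iXY; apply/K0_pi/asboolP/K0_iso. Qed.

(** Whichever proof of [basic A] is selected in [mu], the underlying space is the same. *)
Lemma mu_class I (A : set (I -> k)) (X : variety k) : basic A ->
  isomorphic X (realization I A) -> K0_class X = mu A.
Proof.
by move=> bA iXA; rewrite /mu; case: pselect => // b; apply: K0_class_iso.
Qed.

Lemma muE I (A : set (I -> k)) (bA : basic A) : mu A = K0_class (basic_variety bA).
Proof. by rewrite (mu_class bA) //; apply: isomorphic_refl. Qed.

Lemma mu_iso I J (A : set (I -> k)) (B : set (J -> k)) phi psi :
  basic A -> basic B ->
  (forall x, A x -> B (phi x) /\ psi (phi x) = x) ->
  (forall y, B y -> A (psi y) /\ phi (psi y) = y) ->
  (forall j, rat A (fun x => phi x j)) -> (forall i, rat B (fun y => psi y i)) ->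
  mu A = mu B.
Proof.
move=> bA bB AB BA rphi rpsi; rewrite (muE bA); apply: mu_class => //.
exact: isomorphic_realize AB BA rphi rpsi.
Qed.

Lemma mu_split I (A : set (I -> k)) h : basic A -> pol h ->
  mu A = mu (A `&` [set x | h x = 0]) + mu (A `&` [set x | h x != 0]).
Proof.
move=> bA ph; have b0 := basicI bA (basic_eq0 ph).
have b1 := basicI bA (basic_neq0 ph).
rewrite (muE bA) (muE b0) (muE b1).
apply: etrans (esym (K0D_pi (K0_var _) (K0_var _))); apply/K0_pi/asboolP.
have E0 : realize A `&` realize (A `&` [set x | h x = 0]) =
    realize (A `&` [set x | h x = 0]).
  by apply/seteqP; split=> s; [case | move=> [sz [As hs]]; split].
have E1 : realize A `&` (points (realization I A) `\` realize (A `&` [set x | h x = 0]))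
    = realize (A `&` [set x | h x != 0]).
  apply/seteqP; split=> s.
    move=> [[sz As] [_ nhs]]; split=> //; split=> //.
    by apply/negP => /eqP hs; apply: nhs; split.
  move=> [sz [As hs]]; split=> //; split=> // -[_ [_ hs0]].
  by move: hs; rewrite /= hs0 eqxx.
apply: (@K0_scissor _ _ _ _ (realize (A `&` [set x | h x = 0]))).
- split; first by move=> s [sz [As hs]]; split.
  exists (affine_points #|I| `&` [set s | h (dec s) != 0]).
    exact: (zopen_neq0 (open_points (affine k #|I|)) (pol_polyfun ph)).
  apply/seteqP; split=> s.
    move=> [[sz [_ As]] nhs]; split=> //; split=> //.
    by apply/negP => /eqP hs; apply: nhs; split.
  move=> [[sz hs] [_ As]]; split=> // -[_ [_ hs0]].
  by move: hs; rewrite /= hs0 eqxx.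
- apply: isomorphic_sym; have := subspace_subspace (affine k #|I|) (realize A)
    (realize (A `&` [set x | h x = 0])).
  by rewrite E0.
- apply: isomorphic_sym; have := subspace_subspace (affine k #|I|) (realize A)
    (points (realization I A) `\` realize (A `&` [set x | h x = 0])).
  by rewrite E1.
Qed.

(** Cutting the empty set by the zero function yields two copies of it, so its class equals its own
    double. *)
Lemma mu_empty I (A : set (I -> k)) : basic A -> (forall x, ~ A x) -> mu A = 0.
Proof.
move=> bA A0; have := mu_split bA (pol_cst I 0).
have -> : A `&` [set x | (0 : k) = 0] = A by apply/seteqP; split=> x; [case|].
have -> : A `&` [set x | (0 : k) != 0] = A.
  by apply/seteqP; split=> x; [case|move/A0].
by move/eqP; rewrite -subr_eq0 opprD addrA subrr sub0r oppr_eq0 => /eqP.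
Qed.

Lemma mu_prod I J (A : set (I -> k)) (B : set (J -> k)) : basic A -> basic B ->
  mu [set z : I + J -> k | A (fun i => z (inl i)) /\ B (fun j => z (inr j))]
  = mu A * mu B.
Proof.
move=> bA bB; set P := [set z | _].
have bP : basic P.
  by apply: basicI; apply: basic_preimage => // c; apply: pol_coord.
rewrite (muE bA) (muE bB) (muE bP).
apply: etrans (esym (K0M_pi (K0_var _) (K0_var _))); apply/esym/K0_pi/asboolP.
apply: K0_product.
pose p (s : seq k) := enc (fun i => @dec (I + J)%type s (inl i)).
pose q (s : seq k) := enc (fun j => @dec (I + J)%type s (inr j)).
have dp s i : dec (p s) i = @dec (I + J)%type s (inl i) by rewrite /p encK.
have dq s j : dec (q s) j = @dec (I + J)%type s (inr j) by rewrite /q encK.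
have coordP c : exists f g, [/\ polyfun #|{: I + J}| f, polyfun #|{: I + J}| g
    & forall s, size s = #|{: I + J}| -> realize P s ->
        g s != 0 /\ @dec (I + J)%type s c = f s / g s].
  exists (fun s => dec s c), (fun=> 1); split=> [||s _ _].
  - exact: polyfun_coord.
  - exact: polyfun_cst.
  - by rewrite oner_neq0 divr1.
exists p, q; split.
- apply: regular_map_frac => [s sz [_ [As Bs]]|i].
    by split; [exact: size_enc | split; [exact: size_enc | rewrite encK]].
  have [f [g [pf pg E]]] := coordP (inl (enum_val i)).
  by exists f, g; split=> // s sz Ps; rewrite nth_enc; apply: E.
- apply: regular_map_frac => [s sz [_ [As Bs]]|j].
    by split; [exact: size_enc | split; [exact: size_enc | rewrite encK]].
  have [f [g [pf pg E]]] := coordP (inr (enum_val j)).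
  by exists f, g; split=> // s sz Ps; rewrite nth_enc; apply: E.
move=> T u v ru rv; split.
  (* The pairing required by the universal property joins the coordinates of [u] and [v]. *)
  pose h t : seq k := enc (fun c : I + J => match c with
    inl i => dec (u t) i | inr j => dec (v t) j end).
  have dh t c : @dec (I + J)%type (h t) c =
      match c with inl i => dec (u t) i | inr j => dec (v t) j end.
    by rewrite /h encK.
  exists h.
    apply: regular_map_to_affine => [t Tt|c].
      have [mu_ _ _] := ru; have [mv_ _ _] := rv.
      have [_ [_ Au]] := mu_ t Tt; have [_ [_ Bv]] := mv_ t Tt.
      split; first exact: size_enc.
      by split; [exact: size_enc | rewrite /h encK].
    rewrite [X in regular _ _ X](_ : _ = fun t => match enum_val c with
        inl i => dec (u t) i | inr j => dec (v t) j end); last first.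
      by apply/funext => t; rewrite nth_enc.
    case: (enum_val c) => [i|j].
      exact: (regular_map_coord (enum_rank i) ru).
    exact: (regular_map_coord (enum_rank j) rv).
  move=> t Tt; have [mu_ _ _] := ru; have [mv_ _ _] := rv.
  have [su _] := mu_ t Tt; have [sv _] := mv_ t Tt.
  split.
    rewrite -[RHS](@decK I) // /p; congr enc; apply/funext => i; exact: dh.
  rewrite -[RHS](@decK J) // /q; congr enc; apply/funext => j; exact: dh.
move=> h h' [mh _ _] [mh' _ _] E t Tt.
have [sh _] := mh t Tt; have [sh' _] := mh' t Tt; have [Ep Eq] := E t Tt.
rewrite -[LHS](@decK (I + J)%type) // -[RHS](@decK (I + J)%type) //.
congr enc; apply/funext => -[i|j].
  by rewrite -!dp Ep.
by rewrite -!dq Eq.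
Qed.

Lemma realizeT I : realize [set: I -> k] = affine_points #|I|.
Proof. by apply/seteqP; split=> s; [case | move=> sz; split]. Qed.

Lemma mu_affine I : mu [set: I -> k] = K0_class (affine_space k #|I|).
Proof.
apply/esym/mu_class; first exact: basicT.
by rewrite realizeT; apply/isomorphic_sym/subspace_points.
Qed.

Lemma K0_affine n : K0_class (affine_space k n) = Lefschetz k ^+ n.
Proof.
elim: n => [|n IHn].
  by rewrite expr0; apply/K0_pi/asboolP/K0_point.
have := mu_prod (basicT k 'I_n) (basicT k 'I_1).
set P := [set z | _]; have -> : P = setT by apply/seteqP; split.
by rewrite !mu_affine card_sum !card_ord addn1 IHn exprSr.
Qed.

Lemma mu_cylinder I J (A : set (I -> k)) : basic A ->
  mu [set z : I + J -> k | A (fun i => z (inl i))] = mu A * Lefschetz k ^+ #|J|.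
Proof.
move=> bA; rewrite -K0_affine -mu_affine -mu_prod //; last exact: basicT.
by congr mu; apply/seteqP; split=> z //= [].
Qed.

End MotivicClass.

(** * The nullcone as a zero locus of traces *)

Section NullconeTraces.
Variables (Q : quiver) (k : numClosedFieldType) (d : dimvec Q).

Local Notation basis := {i : vertex Q & 'I_(d i)}.
Local Notation rep := (forall a : arrow Q, 'M[k]_(d (tgt a), d (src a))).

Definition rep_of (x : rep_coord d -> k) : rep :=
  fun a => \matrix_(p, q) x (Tagged _ (p, q)).

(** The [(i, j)] block of the identity matrix on [basis], typed without a case distinction on
    [i = j]. *)
Definition conn i j : 'M[k]_(d i, d j) :=
  \matrix_(p, q) ((Tagged _ p : basis) == (Tagged _ q : basis))%:R.

Lemma conn1 i : conn i i = 1%:M.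
Proof. by apply/matrixP => p q; rewrite !mxE eq_Tagged. Qed.

Lemma conn0 i j : i != j -> conn i j = 0.
Proof.
move=> ne; apply/matrixP => p q; rewrite !mxE; case: eqP => // /(congr1 tag) /= ij.
by rewrite ij eqxx in ne.
Qed.

(** [E i] embeds the space at vertex [i] into a total space, and [F i] projects onto it. *)
Definition frame_mx N (E : forall i, 'M[k]_(N, d i)) (F : forall i, 'M[k]_(d i, N))
  (V : rep) a : 'M[k]_N := E (tgt a) *m V a *m F (src a).

(* Only the products [F i *m E j] enter the traces: hence their invariance under
   base change as well as under the choice of a total space. *)
Lemma tr_word_frame (V : rep) w : exists c, forall N E F,
  (forall i j, F i *m E j = conn i j) -> w <> [::] ->
  \tr (word (@frame_mx N E F V) w) = c.
Proof.
(* A nonempty word has the form [E K F] with [K] independent of the frame; by cyclicity its trace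
   sees only a product [F E]. The empty word is excluded, since its trace is [N]. *)
suff key a v : exists l (K : 'M[k]_(d (tgt a), d l)), forall N E F,
    (forall i j, F i *m E j = conn i j) ->
    word (@frame_mx N E F V) (a :: v) = E (tgt a) *m K *m F l.
  case: w => [|a w]; first by exists 0.
  have [l [K HK]] := key a w; exists (\tr (K *m conn l (tgt a))) => N E F EF _.
  by rewrite (HK _ E F EF) -mulmxA mxtrace_mulC -mulmxA EF.
elim: v a => [|b v IH] a.
  by exists (src a), (V a) => N E F _; rewrite /= mulmx1.
have [l [K HK]] := IH b.
exists l, (V a *m conn (src a) (tgt b) *m K) => N E F EF.
rewrite -[LHS]/(frame_mx E F V a *m word (frame_mx E F V) (b :: v)).
by rewrite (HK _ E F EF) /frame_mx -EF !mulmxA.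
Qed.

Section Embedding.
Variables (N : nat) (iota : basis -> 'I_N).
Hypothesis iota_inj : injective iota.

Definition sel i : 'M[k]_(d i, N) := \matrix_(p, x) (x == iota (Tagged _ p))%:R.

Lemma mul_selmx i n (M : 'M[k]_(N, n)) p y :
  (sel i *m M) p y = M (iota (Tagged _ p)) y.
Proof.
rewrite mxE (bigD1 (iota (Tagged _ p))) //= mxE eqxx mul1r big1 ?addr0 // => x ne.
by rewrite mxE (negPf ne) mul0r.
Qed.

Lemma mul_mxselT i n (M : 'M[k]_(n, N)) x p :
  (M *m (sel i)^T) x p = M x (iota (Tagged _ p)).
Proof. by rewrite -[M]trmxK -trmx_mul [LHS]mxE mul_selmx !mxE. Qed.

Lemma sel_conn i j : sel i *m (sel j)^T = conn i j.
Proof.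
by apply/matrixP => p q; rewrite mul_mxselT !mxE (inj_eq iota_inj) eq_sym.
Qed.

Definition tot (V : rep) := frame_mx (fun i => (sel i)^T) sel V.

End Embedding.

Lemma tr_nil_embedding N N' (iota : basis -> 'I_N) (iota' : basis -> 'I_N') V :
  injective iota -> injective iota' -> tr_nil (tot iota V) -> tr_nil (tot iota' V).
Proof.
move=> inj inj' tn w w0; have [c H] := tr_word_frame V w.
rewrite (H _ _ _ (sel_conn inj')) // -(H _ _ _ (sel_conn inj)) //.
exact: tn.
Qed.

(** Base change is a change of frame: [g] is absorbed into the embeddings and its inverse into the
    projections. *)
Lemma tr_word_orbit N (iota : basis -> 'I_N) (V W : rep)
    (g : forall i, 'M[k]_(d i)) w : injective iota -> w <> [::] ->
  (forall i, g i \in unitmx) ->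
  (forall a, W a = g (tgt a) *m V a *m invmx (g (src a))) ->
  \tr (word (tot iota W) w) = \tr (word (tot iota V) w).
Proof.
move=> inj w0 gu gW; have [c H] := tr_word_frame V w.
rewrite (H _ _ _ (sel_conn inj)) //.
have := H _ (fun i => (sel iota i)^T *m g i) (fun i => invmx (g i) *m sel iota i).
rewrite /tot /frame_mx => <- //.
  by congr (\tr (word _ w)); apply/funext => a; rewrite gW !mulmxA.
move=> i j; rewrite mulmxA -(mulmxA _ (sel _ i)) sel_conn //.
have [->|ne] := eqVneq i j; first by rewrite conn1 mulmx1 mulVmx.
by rewrite conn0 // mulmx0 mul0mx.
Qed.

Lemma polmx_word (I : finType) (T : Type) N (t : (I -> k) -> T -> 'M[k]_N) w :
  (forall a, polmx (fun x => t x a)) -> polmx (fun x => word (t x) w).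
Proof.
move=> pt; elim: w => [|a w IH]; first exact: polmx_cst.
exact: polmx_mul.
Qed.

Lemma polmx_tot N (iota : basis -> 'I_N) a : polmx (fun x => tot iota (rep_of x) a).
Proof.
apply: polmx_mul (polmx_cst _ _); apply: polmx_mul; first exact: polmx_cst.
by move=> p q; under eq_fun do rewrite mxE; apply: pol_coord.
Qed.

(** The trace of a word minus its value at [V] is a polynomial vanishing on the orbit of [V], hence
    at the zero representation in its closure, where the trace is 0. *)
Lemma nullcone_tr_nil V : nullcone d V -> tr_nil (tot enum_rank (rep_of (dec V))).
Proof.
move=> [_ V0] w w0; have inj := @enum_rank_inj basis.
set c := \tr _; pose f x := \tr (word (tot (@enum_rank basis) (rep_of x)) w) - c.
have fp : pol f.
  by apply: polB (pol_cst _ _); apply/polmx_tr/polmx_word; apply: polmx_tot.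
have [||_ H] := V0 (zero_locus (rep_dim d) [set fun s => f (dec s)]).
- by apply: zero_locus_closed => _ ->; apply: pol_polyfun.
- move=> W [sW [g [gu gW]]]; split=> // _ ->.
  by rewrite /f (tr_word_orbit inj w0 gu gW) subrr.
have /eqP := H _ erefl; rewrite /f subr_eq0 => /eqP <-.
case: w w0 {f fp c H} => // a w _ /=.
rewrite [X in X *m _](_ : _ = 0) ?mul0mx ?mxtrace0 //.
rewrite /tot /frame_mx [rep_of _ a](_ : _ = 0) ?mulmx0 ?mul0mx //.
by apply/matrixP => p q; rewrite !mxE /dec nth_nseq if_same.
Qed.

(** A base change makes [V] strictly triangular; a one-parameter diagonal group then scales all its
    entries by positive powers of [s], so that the limit at [s = 0] is the zero representation. *)
Lemma tr_nil_nullcone V : size V = rep_dim d ->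
  tr_nil (tot enum_rank (rep_of (dec V))) -> nullcone d V.
Proof.
move=> sV tn; split=> //; set t := tot _ _ in tn; set iota := @enum_rank basis.
have inj : injective iota by exact: enum_rank_inj.
pose blk (x : 'I_#|{: basis}|) := tag (enum_val x); pose P := sel iota.
have PtP i : (P i)^T *m P i = blkE k blk i.
  apply/matrixP => x y; rewrite !mxE -[x]enum_valK -[y]enum_valK.
  case: (enum_val x) => j p; rewrite /blk !enum_rankK /=.
  have [ji|ne] := eqVneq j i.
    case: _ / ji; rewrite (bigD1 p) //= big1 ?addr0 => [|q ne]; last first.
      by rewrite !mxE (inj_eq inj) eq_Tagged /= eq_sym (negPf ne) mul0r.
    by rewrite !mxE eqxx mul1r eq_sym.
  rewrite mul0rn big1 // => q _; rewrite !mxE (inj_eq inj).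
  by case: eqP => [[/eqP]|]; rewrite ?(negPf ne) ?mul0r.
have tE a j : blkE k blk j *m t a = (j == tgt a)%:R *: t a.
  rewrite -PtP /t /tot /frame_mx !mulmxA -(mulmxA _ (P j)) sel_conn //.
  have [->|ne] := eqVneq j (tgt a); first by rewrite conn1 mulmx1 scale1r.
  by rewrite conn0 // mulmx0 !mul0mx scale0r.
have [H [w [Hu HE HT]]] := strict_triangular tn tE.
pose S a := H *m t a *m invmx H.
(* The truncated exponent is exact wherever the entry of [S] is nonzero. *)
pose phi s (c : rep_coord d) : k := let x := iota (Tagged (fun i => 'I_(d i)) (tagged c).1) in
  let y := iota (Tagged (fun i => 'I_(d i)) (tagged c).2) in S (tag c) x y * s ^+ (w x - w y).
have phi0 : enc (phi 0) = nseq (rep_dim d) 0.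
  apply: (@eq_from_nth _ 0); rewrite size_enc ?size_nseq // => i lti.
  rewrite nth_nseq if_same (nth_enc _ (Ordinal lti)) /phi expr0n.
  (* At exponent 0, where the power of 0 is 1, the entry of [S] itself vanishes by triangularity. *)
  case: eqP => [/eqP|_]; last by rewrite mulr0.
  rewrite mulr1 => sw; apply/eqP; apply: contraTT sw => /HT.
  by rewrite -subn_gt0 -lt0n.
have phi_orbit s : s != 0 -> rep_orbit d V (enc (phi s)).
  move=> s0; split; first exact: size_enc.
  pose D : 'M[k]_#|{: basis}| := diag_mx (\row_x s ^+ w x).
  pose D' : 'M[k]_#|{: basis}| := diag_mx (\row_x (s ^+ w x)^-1).
  have DD : D *m D' = 1%:M.
    apply/matrixP => x y; rewrite mul_diag_mx !mxE.
    by case: eqP => [->|]; rewrite ?mulr0 // mulr1n mulfV // expf_neq0.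
  have [G [G' [GG GE GS]]] : exists G G', [/\ G *m G' = 1%:M,
      forall j, G *m blkE k blk j = blkE k blk j *m G
    & forall a, G *m t a *m G' = D *m S a *m D'].
    exists (D *m H), (invmx H *m D'); split=> [|j|a].
    - by rewrite mulmxA mulmxK.
    - by rewrite -mulmxA HE !mulmxA; congr (_ *m _); rewrite /D /blkE diag_mxC.
    - by rewrite /S !mulmxA.
  (* As [G] commutes with the block projections, its diagonal blocks form a base change at the
     vertices. *)
  pose g i := P i *m G *m (P i)^T; pose g' i := P i *m G' *m (P i)^T.
  have gg i : g i *m g' i = 1%:M.
    rewrite /g /g' !mulmxA -(mulmxA _ (P i)^T) PtP -(mulmxA (P i) G) GE.
    by rewrite -PtP !mulmxA sel_conn // conn1 mul1mx -(mulmxA _ G) GG mulmx1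
      sel_conn // conn1.
  have gu i : g i \in unitmx by case/mulmx1_unit: (gg i).
  have gV i : invmx (g i) = g' i.
    by rewrite -[RHS]mul1mx -(mulVmx (gu i)) -mulmxA gg mulmx1.
  exists g; split=> // a; rewrite gV.
  transitivity (P (tgt a) *m (D *m S a *m D') *m (P (src a))^T); last first.
    by rewrite -GS /g /g' /t /tot /frame_mx !mulmxA.
  have DE (M : 'M[k]_#|{: basis}|) x y :
      (D *m M *m D') x y = s ^+ w x * M x y * (s ^+ w y)^-1.
    by rewrite mul_mx_diag mul_diag_mx !mxE.
  apply/matrixP => p q; rewrite mul_mxselT mul_selmx DE mxE.
  have := encK (phi s) => /(congr1 (fun f => f (Tagged _ (p, q)))).
  rewrite /dec => ->; rewrite /phi /=; set x := iota _; set y := iota _.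
  have [->|/HT lt_yx] := eqVneq (S a x y) 0; first by rewrite mulr0 !mul0r.
  by rewrite mulrAC mulrC -expfB // ltnW.
move=> Z [_ Zo] oZ; apply: contrapT => nZ.
have [|h [hp h0 hZ]] := zopenP Zo (x := enc (phi 0)).
  by split; [exact: size_enc | rewrite phi0].
have [p pE] : exists p : {poly k}, forall s, h (enc (phi s)) = p.[s].
  elim: hp => [c|i|f1 f2 _ [p1 E1] _ [p2 E2]|f1 f2 _ [p1 E1] _ [p2 E2]].
  - by exists c%:P => s; rewrite hornerC.
  - eexists (_ *: 'X^_) => s.
    by rewrite nth_enc /phi !hornerE; reflexivity.
  - by exists (p1 + p2) => s; rewrite E1 E2 hornerD.
  - by exists (p1 * p2) => s; rewrite E1 E2 hornerM.
(* The factor ['X] forces the non-root [s] to be nonzero, so that [phi s] lies in the orbit. *)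
have /closed_nonrootP[s] : 'X * p != 0.
  rewrite mulf_neq0 ?polyX_eq0 //.
  by apply: contraNneq h0 => p0; rewrite pE p0 horner0.
rewrite /root hornerM hornerX mulf_eq0 negb_or => /andP[s0 ps].
have [] := hZ (enc (phi s)); [exact: size_enc | by rewrite pE |].
by move=> _; apply; apply/oZ/phi_orbit.
Qed.

End NullconeTraces.

(** * Nilpotent representations on coordinate subspaces *)

Section NullconeClass.
Variables (Q : quiver) (k : numClosedFieldType).

Definition nil_rep (d : dimvec Q) : set (rep_coord d -> k) :=
  [set x | tr_nil (tot enum_rank (rep_of x))].
Arguments nil_rep : clear implicits.

Lemma basic_nil_rep d : basic (nil_rep d).
Proof.
apply: (@basic_all_eq0 _ _ _ (fun w => w <> [::])
  (fun w x => \tr (word (tot enum_rank (rep_of x)) w))) => w.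
by apply/polmx_tr/polmx_word; apply: polmx_tot.
Qed.

Lemma nullcone_mu_rep d : K0_class (nullcone_variety k d) = mu (nil_rep d).
Proof.
apply: mu_class; first exact: basic_nil_rep.
have -> : realize (nil_rep d) = nullcone d.
  apply/seteqP; split=> V; first by case=> sV tV; apply: tr_nil_nullcone.
  by move=> NV; split; [case: NV | apply: nullcone_tr_nil].
exact: isomorphic_refl.
Qed.

Variables (N : nat) (blk : 'I_N -> vertex Q).

(** All arrows act on one space $k^N$, so that representations of different dimension vectors share
    their coordinates and differ only in their support. *)
Definition mat_coord : finType := (arrow Q * 'I_N * 'I_N)%type.

Definition mat (t : mat_coord -> k) a : 'M[k]_N := \matrix_(x, y) t (a, x, y).

Lemma polmx_mat a : polmx (fun t => mat t a).
Proof. by move=> x y; under eq_fun do rewrite mxE; apply: pol_coord. Qed.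

Definition block_support (U : {set 'I_N}) (t : mat_coord -> k) :=
  forall a x y, ~~ [&& x \in U, y \in U, blk x == tgt a & blk y == src a] ->
    t (a, x, y) = 0.

(* Nilpotent representations on the span of the basis vectors in [U]. *)
Definition nil_mat (U : {set 'I_N}) : set (mat_coord -> k) :=
  [set t | block_support U t /\ tr_nil (mat t)].

Lemma basic_nil_mat U : basic (nil_mat U).
Proof.
apply: basicI; last first.
  apply: (@basic_all_eq0 _ _ _ (fun w => w <> [::])
    (fun w t => \tr (word (mat t) w))) => w.
  by apply/polmx_tr/polmx_word; apply: polmx_mat.
have := @basic_all_eq0 _ _ _ (fun c : mat_coord => ~~ [&& c.1.2 \in U, c.2 \in U,
  blk c.1.2 == tgt c.1.1 & blk c.2 == src c.1.1]) _ (@pol_coord k mat_coord).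
apply: basic_ext => t; split=> [H a x y|H [[a x] y]]; last exact: H.
exact: (H (a, x, y)).
Qed.

Lemma tot_iota (d : dimvec Q) (iota : {i : vertex Q & 'I_(d i)} -> 'I_N) V a p q :
  injective iota ->
  tot (k := k) iota V a (iota (Tagged _ p)) (iota (Tagged _ q)) = V a p q.
Proof.
move=> inj; rewrite -mul_selmx -mul_mxselT /tot /frame_mx !mulmxA sel_conn //.
by rewrite -(mulmxA _ (sel _ _ _)) sel_conn // !conn1 mul1mx mulmx1.
Qed.

(** Numbering each block of [U] identifies the entries of a representation with the matrix entries
    allowed by the support; nilpotency carries over because traces of words do not depend on the
    embedding. *)
Lemma nullcone_mu (d : dimvec Q) (U : {set 'I_N}) :
  (forall i, d i = #|[set x in U | blk x == i]%SET|) ->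
  K0_class (nullcone_variety k d) = mu (nil_mat U).
Proof.
move=> dE; rewrite nullcone_mu_rep.
pose iota (x : {i : vertex Q & 'I_(d i)}) : 'I_N :=
  enum_val (cast_ord (dE (tag x)) (tagged x)).
have iotaP x : iota x \in U /\ blk (iota x) = tag x.
  have := enum_valP (cast_ord (dE (tag x)) (tagged x)).
  by rewrite finset.inE => /andP[? /eqP].
have inj : injective iota.
  move=> [i p] [j q] E; have ij : i = j.
    by have := (iotaP (Tagged _ p)).2; rewrite E (iotaP _).2.
  by case: _ / ij q E => q /enum_val_inj /cast_ord_inj /= ->.
have surj x i : x \in U -> blk x = i -> exists p : 'I_(d i), x = iota (Tagged _ p).
  move=> xU xi; have xA : x \in [set x in U | blk x == i]%SET.
    by rewrite finset.inE xU xi eqxx.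
  exists (cast_ord (esym (dE i)) (enum_rank_in xA x)).
  by rewrite /iota cast_ordKV enum_rankK_in.
have tot0 V a x y : ~~ [&& x \in U, y \in U, blk x == tgt a & blk y == src a] ->
    tot (k := k) iota V a x y = 0.
  have [xP|xP] := boolP ((x \in U) && (blk x == tgt a)); last first.
    move=> _; rewrite /tot /frame_mx -mulmxA mxE big1 // => p _; rewrite !mxE.
    case: eqP => [xE|]; last by rewrite mul0r.
    by have [xU xb] := iotaP (Tagged (fun i => 'I_(d i)) p); rewrite xE xU xb eqxx in xP.
  case/andP: xP => -> -> /=; rewrite andbC /= => yP.
  rewrite /tot /frame_mx mxE big1 // => q _; rewrite [X in _ * X]mxE.
  case: eqP => [yE|]; last by rewrite mulr0.
  by have [yU yb] := iotaP (Tagged (fun i => 'I_(d i)) q); rewrite yE yU yb eqxx in yP.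
have rk_inj := @enum_rank_inj {i : vertex Q & 'I_(d i)}.
apply: (@mu_iso _ _ _ _ _
  (fun x (c : mat_coord) => tot iota (rep_of x) c.1.1 c.1.2 c.2)
  (fun t (c : rep_coord d) => t (tag c, iota (Tagged (fun i => 'I_(d i)) (tagged c).1),
                                       iota (Tagged (fun i => 'I_(d i)) (tagged c).2)))).
- exact: basic_nil_rep.
- exact: basic_nil_mat.
- move=> x tx; split; first split=> [a y z|].
  + exact: tot0.
  + rewrite (_ : mat _ = tot iota (rep_of x)).
      exact: tr_nil_embedding tx.
    by apply/funext => a; apply/matrixP => y z; rewrite mxE.
  + by apply/funext => -[a [p q]]; rewrite tot_iota // mxE.
- move=> t [st tt]; set x := (fun c : rep_coord d => _).
  have E a y z : tot iota (rep_of x) a y z = t (a, y, z).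
    have [/and4P[yU zU /eqP yb /eqP zb]|out] :=
      boolP [&& y \in U, z \in U, blk y == tgt a & blk z == src a].
      have [p ->] := surj _ _ yU yb; have [q ->] := surj _ _ zU zb.
      by rewrite tot_iota // mxE.
    by rewrite tot0 // st.
  split; last by apply/funext => -[[a y] z]; apply: E.
  apply: (@tr_nil_embedding _ _ _ _ _ iota) => //.
  rewrite (_ : tot _ _ = mat t) //.
  by apply/funext => a; apply/matrixP => y z; rewrite E mxE.
- by move=> [[a x] y]; apply/rat_pol/polmx_tot.
- by move=> c; apply/rat_pol/pol_coord.
Qed.

End NullconeClass.

(** * Representations with vectors in their kernel *)

Section NilFamilies.
Variables (k : numClosedFieldType) (I : Type) (N : nat).
Implicit Types t : I -> 'M[k]_N.

Lemma comm_invmx (G E : 'M[k]_N) : G \in unitmx ->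
  G *m E = E *m G -> invmx G *m E = E *m invmx G.
Proof.
by move=> Gu GE; apply: (can_inj (mulKmx Gu)); rewrite mulKVmx // mulmxA GE mulmxK.
Qed.

Lemma tr_nil_conj t (G : 'M[k]_N) : G \in unitmx -> tr_nil t ->
  tr_nil (fun a => G *m t a *m invmx G).
Proof.
move=> Gu tn w w0; rewrite word_conj // mxtrace_mulC mulmxA mulVmx // mul1mx.
exact: tn.
Qed.

(** Inside the word every [P] but the first is absorbed by the factor on its left; by cyclicity the
    last factor absorbs the first [P]. *)
Lemma tr_word_mull t (P : 'M[k]_N) w : (forall a, t a *m P = t a) -> w <> [::] ->
  \tr (word (fun a => P *m t a) w) = \tr (word t w).
Proof.
move=> tP; case: w => // a w _.
have -> : word (fun a => P *m t a) (a :: w) = P *m word t (a :: w).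
  elim: w a => [|b w IH] a; first by rewrite /= !mulmx1.
  rewrite -[LHS]/(P *m t a *m word (fun a => P *m t a) (b :: w)) IH.
  by rewrite mulmxA -(mulmxA P) tP -mulmxA.
rewrite mxtrace_mulC; congr (\tr _); elim: w a => [|b w IH] a /=.
  by rewrite mulmx1 tP.
by rewrite -mulmxA IH.
Qed.

(** Transposition reverses words. This adapts [socle_step], which acts on row vectors, to kernels of
    column vectors. *)
Lemma tr_nil_tr t : tr_nil t -> tr_nil (fun a => (t a)^T).
Proof.
move=> tn w w0; have -> : word (fun a => (t a)^T) w = (word t (rev w))^T.
  elim: w {w0} => [|a w IH] /=; first by rewrite trmx1.
  by rewrite IH rev_cons -cats1 word_cat /= mulmx1 trmx_mul.
rewrite mxtrace_tr; apply: tn; case: w w0 => // a w _.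
by rewrite rev_cons; case: (rev w).
Qed.

End NilFamilies.

(** * Families of kernel vectors as unitriangular matrices *)

Section Frames.
Variables (Q : quiver) (k : numClosedFieldType) (N : nat) (blk : 'I_N -> vertex Q).

Local Notation mat_coord := (mat_coord Q N).
Local Notation L := (Lefschetz k).
Implicit Types (T : {set 'I_N}) (t : mat_coord -> k).

Definition pair_coord : finType := (mat_coord + 'I_N * 'I_N)%type.
Implicit Type z : pair_coord -> k.

Definition tpart z (c : mat_coord) := z (inl c).
(** Under [low_support T], column [y] is a vector with leading term [e_y] for [y] in [T], and [e_y]
    itself otherwise. *)
Definition frame_of z : 'M[k]_N := 1%:M + \matrix_(x, y) z (inr (x, y)).

Lemma polmx_frame_of : polmx frame_of.
Proof.
apply: polmx_add => [|x y]; first exact: polmx_cst.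
by under eq_fun do rewrite mxE; apply: pol_coord.
Qed.

Lemma polmx_tpart a : polmx (fun z => mat (tpart z) a).
Proof. by move=> x y; under eq_fun do rewrite mxE; apply: pol_coord. Qed.

Definition low T (x y : 'I_N) := [&& y \in T, (x < y)%N & blk x == blk y].

Definition low_support T z := forall x y, ~~ low T x y -> z (inr (x, y)) = 0.

(* Representations in [B] together with a vector with leading term [e_y] in
   their common kernel for every [y] in [T]. *)
Definition kernel_frames T (B : set (mat_coord -> k)) : set (pair_coord -> k) :=
  [set z | [/\ B (tpart z), low_support T z
    & forall a x y, y \in T -> (mat (tpart z) a *m frame_of z) x y = 0]].

Definition split_frames T : set (pair_coord -> k) :=
  [set z | [/\ nil_mat blk [set: 'I_N]%SET (tpart z), low_support T z
    & forall a x y, y \in T -> tpart z (a, x, y) = 0]].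

Lemma basic_low_support T : basic (low_support T).
Proof.
have := @basic_all_eq0 _ _ _ (fun c : 'I_N * 'I_N => ~~ low T c.1 c.2) _
  (fun c => @pol_coord k pair_coord (inr c)).
apply: basic_ext => z; split=> [H x y|H [x y]]; last exact: H.
exact: (H (x, y)).
Qed.

Lemma basic_kernel_frames T B : basic B -> basic (kernel_frames T B).
Proof.
move=> bB; have b1 : basic [set z | B (tpart z)].
  by apply: basic_preimage => // c; apply: pol_coord.
have := basicI b1 (basicI (basic_low_support T) (@basic_all_eq0 _ _ _
  (fun c : mat_coord => c.2 \in T)
  (fun c z => (mat (tpart z) c.1.1 *m frame_of z) c.1.2 c.2) _)).
move=> H; apply: (basic_ext _ (H _)) => [z|c]; last first.
  by apply: polmx_mul; [exact: polmx_tpart | exact: polmx_frame_of].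
split=> [[Bz [lz kz]]|[Bz lz kz]]; split=> //.
  by move=> a x y yT; apply: (kz (a, x, y)).
by split=> // -[[a x] y] yT; apply: kz.
Qed.

Lemma basic_split_frames T : basic (split_frames T).
Proof.
have b1 : basic [set z | nil_mat blk [set: 'I_N]%SET (tpart z)].
  by apply: basic_preimage (basic_nil_mat _ _ _) _ => c; apply: pol_coord.
have := basicI b1 (basicI (basic_low_support T) (@basic_all_eq0 _ _ _
  (fun c : mat_coord => c.2 \in T) (fun c z => tpart z c) _)).
move=> H; apply: (basic_ext _ (H _)) => [z|c]; last exact: pol_coord.
split=> [[Bz [lz kz]]|[Bz lz kz]]; split=> //.
  by move=> a x y yT; apply: (kz (a, x, y)).
by split=> // -[[a x] y] yT; apply: kz.
Qed.

Lemma frame_of_unit T z : low_support T z -> frame_of z \in unitmx.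
Proof.
move=> lz; have z0 (x y : 'I_N) : (y <= x)%N -> z (inr (x, y)) = 0.
  by move=> le_yx; apply: lz; rewrite /low ltnNge le_yx andbF.
rewrite -unitmx_tr unitmxE det_trig; last first.
  apply/is_trig_mxP => x y ltxy; rewrite !mxE z0 1?ltnW // addr0.
  by case: eqP ltxy => // ->; rewrite ltnn.
rewrite big1 ?unitr1 // => x _; rewrite !mxE eqxx z0 // addr0 //.
Qed.

Lemma frame_of_block T z j : low_support T z ->
  frame_of z *m blkE k blk j = blkE k blk j *m frame_of z.
Proof.
move=> lz; rewrite /blkE mul_mx_diag mul_diag_mx; apply/matrixP => x y; rewrite !mxE.
rewrite mulrDr mulrDl; congr (_ + _).
  by case: eqP => [->|_]; rewrite ?mulr0 ?mul0r // mulrC.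
have [/and3P[_ _ /eqP ->]|/lz ->] := boolP (low T x y); first by rewrite mulrC.
by rewrite mulr0 mul0r.
Qed.

(** In this form the condition is visibly stable under conjugation by matrices commuting with the
    block projections. *)
Lemma block_supportP t : block_support blk [set: 'I_N]%SET t <->
  forall a, blkE k blk (tgt a) *m mat t a *m blkE k blk (src a) = mat t a.
Proof.
have E a x y : (blkE k blk (tgt a) *m mat t a *m blkE k blk (src a)) x y =
    if (blk x == tgt a) && (blk y == src a) then t (a, x, y) else 0.
  rewrite /blkE mul_mx_diag mul_diag_mx !mxE.
  by case: eqP => _; case: eqP => _; rewrite ?mul0r ?mulr0 ?mul1r ?mulr1.
split=> [st a|H a x y].
  apply/matrixP => x y; rewrite E mxE; case: ifP => // out.
  by rewrite st // !finset.inE out.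
rewrite !finset.inE /= => out.
by have := E a x y; rewrite H mxE (negPf out).
Qed.

Lemma nil_mat_conj t t' G : nil_mat blk [set: 'I_N]%SET t -> G \in unitmx ->
  (forall j, G *m blkE k blk j = blkE k blk j *m G) ->
  (forall a, mat t' a = G *m mat t a *m invmx G) -> nil_mat blk [set: 'I_N]%SET t'.
Proof.
move=> [/block_supportP st tn] Gu GE tt'.
have GE' j : blkE k blk j *m invmx G = invmx G *m blkE k blk j.
  by rewrite comm_invmx.
split.
  apply/block_supportP => a; rewrite tt' !mulmxA -GE -!mulmxA -GE' !mulmxA.
  by rewrite -[in RHS](st a) !mulmxA.
rewrite (_ : mat t' = fun a => G *m mat t a *m invmx G); last exact/funext.
exact: tr_nil_conj.
Qed.

Lemma mulmx_col0 m n p (A : 'M[k]_(m, n)) (M : 'M_(n, p)) y :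
  (forall x, M x y = 0) -> forall x, (A *m M) x y = 0.
Proof. by move=> M0 x; rewrite mxE big1 // => l _; rewrite M0 mulr0. Qed.

(** The frame stays among the coordinates, so the conjugation by it can be undone; it is rational
    because the frame is invertible. *)
Lemma mu_kernel_frames T :
  mu (kernel_frames T (nil_mat blk [set: 'I_N]%SET)) = mu (split_frames T).
Proof.
pose conj G (z : pair_coord -> k) (c : pair_coord) : k := match c with
  inl (a, x, y) => (G *m mat (tpart z) a *m invmx G) x y | inr e => z (inr e) end.
have matE G z a : mat (tpart (conj G z)) a = G *m mat (tpart z) a *m invmx G.
  by apply/matrixP => x y; rewrite mxE.
have frE G z : frame_of (conj G z) = frame_of z by [].
apply: (@mu_iso _ _ _ _ _ (fun z => conj (invmx (frame_of z)) z)
                          (fun z => conj (frame_of z) z)).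
- exact/basic_kernel_frames/basic_nil_mat.
- exact: basic_split_frames.
- move=> z [Nz lz kz]; have Gu := frame_of_unit lz.
  split; last first.
    apply/funext => -[[[a x] y]|//] /=; rewrite matE frE invmxK.
    by rewrite !mulmxA mulmxV // mul1mx mulmxK // mxE.
  split=> //.
    apply: (@nil_mat_conj (tpart z) _ (invmx (frame_of z))) => //.
      by rewrite unitmx_inv.
    by move=> j; apply: comm_invmx => //; apply: frame_of_block lz.
  move=> a x y yT; rewrite /tpart /= invmxK -mulmxA.
  by apply: mulmx_col0 => x'; apply: kz.
- move=> z [Nz lz kz]; have Gu := frame_of_unit lz.
  split; last first.
    apply/funext => -[[[a x] y]|//] /=; rewrite matE frE invmxK.
    by rewrite !mulmxA mulVmx // mul1mx mulmxKV // mxE.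
  split=> //.
    by apply: (@nil_mat_conj (tpart z) _ (frame_of z)) => // j; apply: frame_of_block lz.
  move=> a x y yT; rewrite matE frE mulmxKV //.
  by apply: mulmx_col0 => x'; rewrite mxE; apply: kz.
- case=> [[[a x] y]|e] /=; last exact/rat_pol/pol_coord.
  under eq_fun do rewrite invmxK.
  apply: ratmx_mul; last exact/ratmx_pol/polmx_frame_of.
  apply: ratmx_mul; last exact/ratmx_pol/polmx_tpart.
  by apply: ratmx_inv => [|z [_ lz _]]; [exact: polmx_frame_of|exact: frame_of_unit lz].
- case=> [[[a x] y]|e] /=; last exact/rat_pol/pol_coord.
  apply: ratmx_mul; last first.
    by apply: ratmx_inv => [|z [_ lz _]]; [exact: polmx_frame_of|exact: frame_of_unit lz].
  by apply: ratmx_mul; apply: ratmx_pol; [exact: polmx_frame_of | exact: polmx_tpart].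
Qed.

(* The coordinates on [split_frames T] besides those of the nilpotent
   representation on the complement of [T]. *)
Definition free_coord T (c : pair_coord) := match c with
  | inl (a, x, y) => [&& x \in T, y \notin T, blk x == tgt a & blk y == src a]
  | inr (x, y) => low T x y
  end.

(** The columns in [T] vanish, so nilpotency concerns only the quotient on the complement of [T];
    the rows in [T] are free within the block pattern, and so is the frame. *)
Lemma mu_split_frames T : mu (split_frames T) =
  mu (nil_mat blk (~: T)%SET) * L ^+ #|[pred c | free_coord T c]|.
Proof.
pose F : finType := {c : pair_coord | free_coord T c}.
have <- : #|F| = #|[pred c | free_coord T c]| by rewrite card_sig.
rewrite -mu_cylinder; last exact: basic_nil_mat.
(* Left multiplication by [P] erases the rows in [T], while right multiplication fixes matrices
   whose columns in [T] vanish; [tr_word_mull] then compares the traces. *)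
pose P : 'M[k]_N := diag_mx (\row_x (x \notin T)%:R).
have PE (M : 'M[k]_N) x y : (P *m M) x y = if x \notin T then M x y else 0.
  rewrite mul_diag_mx !mxE; case: ifP => _; by rewrite ?mul1r ?mul0r.
have tP t : (forall a x y, y \in T -> t (a, x, y) = 0) -> forall a, mat t a *m P = mat t a.
  move=> t0 a; apply/matrixP => x y; rewrite mul_mx_diag !mxE.
  by have [/t0 ->|_] := boolP (y \in T); rewrite ?mul0r // mulr1.
apply: (@mu_iso _ _ _ _ _ (fun z (c : mat_coord + F) => match c with
     | inl (a, x, y) => if x \notin T then z (inl (a, x, y)) else 0
     | inr f => z (val f) end)
  (fun w c => if insub c is Some f then w (inr f) else
     if c is inl m then w (inl m) else 0)).
- exact: basic_split_frames.
- by apply: basic_preimage (basic_nil_mat _ _ _) _ => c; apply: pol_coord.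
- move=> z [[sz nz] lz kz]; split; first split.
  + move=> a x y; rewrite !finset.inE /=; case: ifP => // xT.
    have [yT|yT] := boolP (y \in T); first by rewrite [z _]kz.
    by move=> /= out; apply: sz; rewrite !finset.inE.
  + rewrite (_ : mat _ = fun a => P *m mat (tpart z) a).
      by move=> w w0; rewrite tr_word_mull //; [exact: nz | apply: tP].
    by apply/funext => a; apply/matrixP => x y; rewrite PE !mxE.
  + apply/funext => c; case: insubP => [f _ <- //|].
    case: c => [[[a x] y]|[x y]] /= out; last by rewrite lz.
    case: ifP => // /negbFE xT; have [yT|yT] := boolP (y \in T).
      by rewrite [z _]kz.
    by rewrite [z _]sz // !finset.inE /=; move: out; rewrite xT yT.
- move=> w [sw nw]; set z := (fun c : pair_coord => _).
  have zE a x y : x \notin T -> z (inl (a, x, y)) = w (inl (a, x, y)).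
    by move=> xT; rewrite /z insubF //= (negPf xT).
  have z0 a x y : y \in T -> z (inl (a, x, y)) = 0.
    move=> yT; rewrite /z insubF /= ?yT ?andbF //.
    by apply: sw; rewrite !finset.inE yT andbF.
  split; last first.
    apply/funext => -[[[a x] y]|f]; last by rewrite /z valK.
    case: ifP => [xT|/negbFE xT]; first exact: zE.
    by rewrite sw // !finset.inE xT.
  split=> //; first split.
  + move=> a x y; rewrite !finset.inE /= => out; rewrite /tpart /z.
    case: insubP => [f|_]; first by rewrite /= (negPf out) !andbF.
    by apply: sw; rewrite (negPf out) !andbF.
  + move=> v v0; rewrite -(@tr_word_mull _ _ _ _ P) //; last exact: tP.
    have := nw v v0; congr (\tr (word _ v) = _).
    apply/funext => a; apply/matrixP => x y; rewrite PE !mxE.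
    case: ifP => [xT|/negbFE xT]; first by rewrite /tpart zE.
    by rewrite sw // !finset.inE xT.
  + by move=> x y out; rewrite /z insubF //=; apply: negbTE.
- case=> [[[a x] y]|f]; last exact/rat_pol/pol_coord.
  by case: (x \notin T); apply: rat_pol; [exact: pol_coord | exact: pol_cst].
- move=> c; case: (insub c) => [f|]; first exact/rat_pol/pol_coord.
  by case: c => [m|_]; apply: rat_pol; [exact: pol_coord | exact: pol_cst].
Qed.

(** The first sum is the arrow part of the recursion exponent; the second, over all [T] with given
    block sizes, produces the q-binomials and the remaining power. *)
Lemma card_free_coord T : #|[pred c | free_coord T c]| =
  (\sum_a #|[set x in T | blk x == tgt a]%SET|
        * #|[set y in ~: T | blk y == src a]%SET|
   + \sum_(y in T) #|[set x : 'I_N | (x < y)%N & blk x == blk y]%SET|)%N.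
Proof.
rewrite -sum1_card big_mkcond big_sumType /=; congr (_ + _)%N.
  transitivity (\sum_a \sum_x \sum_y (free_coord T (inl (a, x, y)) : nat))%N.
    rewrite !pair_bigA /=; apply: eq_bigr => -[[a x] y] _.
    by rewrite !unfold_in /=; case: ifP.
  apply: eq_bigr => a _; rewrite -!sum1_card big_distrl /= [RHS]big_mkcond /=.
  apply: eq_bigr => x _; rewrite finset.inE mul1n.
  case: ifP => [/andP[xT xa]|out].
    rewrite [RHS]big_mkcond; apply: eq_bigr => y _.
    by rewrite xT xa !finset.inE /=; case: (_ && _).
  rewrite big1 // => y _; case: (y \notin T); rewrite /= ?andbF //.
  by rewrite andbA out.
transitivity (\sum_x \sum_y (low T x y : nat))%N.
  rewrite pair_bigA /=; apply: eq_bigr => -[x y] _.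
  by rewrite !unfold_in /=; case: ifP.
rewrite exchange_big [RHS]big_mkcond; apply: eq_bigr => y _; rewrite /low.
case: (y \in T) => /=; last by rewrite big1.
by rewrite -sum1_card [RHS]big_mkcond; apply: eq_bigr => x _; rewrite finset.inE; case: (_ && _).
Qed.

End Frames.

(** * The alternating sum over subsets of the basis vanishes *)

(** Pairs each subset avoiding [m] with the one obtained by adding [m]. This serves both the
    cancellation of signs and the q-binomial induction. *)
Lemma big_setU1_split (A : nmodType) (J : finType) (m : J) (S : {set J})
    (F : {set J} -> A) : m \notin S ->
  \sum_(T : {set J} | T \subset m |: S) F T =
  \sum_(T : {set J} | T \subset S) (F T + F (m |: T)%SET).
Proof.
move=> mS; rewrite (bigID (fun T : {set J} => m \in T)) /= addrC big_split /=.
have Sm (T : {set J}) : T \subset S -> m \notin T.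
  by move=> /fintype.subsetP TS; apply: contra mS => /TS.
congr (_ + _).
  apply: eq_bigl => T; apply/andP/idP => [[/fintype.subsetP TS mT]|TS].
    apply/fintype.subsetP => x xT; have := TS x xT; rewrite !finset.inE.
    by case/orP => // /eqP xm; rewrite -xm xT in mT.
  by split; [apply: fintype.subset_trans TS (finset.subsetUr _ _) | apply: Sm].
rewrite (reindex_onto (fun T => m |: T)%SET (fun T => T :\ m)%SET) /=; last first.
  by move=> T /andP[_ mT]; rewrite finset.setD1K.
apply: eq_bigl => T; rewrite finset.in_setU1 eqxx /= andbT.
apply/andP/idP => [[mTS /eqP TE]|TS]; last first.
  by rewrite finset.setU1K ?Sm // finset.setUS.
have mT : m \notin T by rewrite -TE finset.in_setD1 eqxx.
apply/fintype.subsetP => x xT.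
have := fintype.subsetP mTS x; rewrite !finset.inE xT orbT => /(_ isT).
by case/orP => // /eqP xm; rewrite -xm xT in mT.
Qed.

(** * Common kernel vectors and their leading terms *)

Section KernelVectors.
Variables (Q : quiver) (k : numClosedFieldType) (N : nat) (blk : 'I_N -> vertex Q).

Local Notation mat_coord := (mat_coord Q N).
Local Notation C := #|{: arrow Q * 'I_N}|.
Local Notation nil := (nil_mat blk [set: 'I_N]%SET).
Implicit Types (T : {set 'I_N}) (t : mat_coord -> k).

(* Rows are indexed by the basis, so that the kernel common to all arrows
   becomes a left kernel. *)
Definition stack t : 'M[k]_(N, C) :=
  \matrix_(x, c) t ((enum_val c).1, (enum_val c).2, x).

Lemma mul_stack t (u : 'rV[k]_N) c :
  (u *m stack t) 0 c = \sum_x u 0 x * t ((enum_val c).1, (enum_val c).2, x).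
Proof. by rewrite mxE; apply: eq_bigr => x _; rewrite mxE. Qed.

Definition below m (u : 'rV[k]_N) := forall x : 'I_N, (m <= x)%N -> u 0 x = 0.

(* Its left kernel consists of the kernel vectors supported below [m]. *)
Definition kermat m t : 'M[k]_(N, C + N) :=
  row_mx (\matrix_(x, c) if (x < m)%N then stack t x c else 0)
         (\matrix_(x, y) ((m <= x)%N && (x == y))%:R).

Lemma mul_kermat_below m t u : below m u -> u *m kermat m t = row_mx (u *m stack t) 0.
Proof.
move=> um; rewrite mul_mx_row; congr row_mx; apply/rowP => j; rewrite !mxE.
  apply: eq_bigr => x _; rewrite [in LHS]mxE; case: ltnP => // /um ->.
  by rewrite !mul0r.
apply: big1 => x _; rewrite mxE; case: leqP => [/um ->|_]; first by rewrite mul0r.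
by rewrite mulr0.
Qed.

Lemma ker_kermat m t u : u *m kermat m t = 0 -> below m u /\ u *m stack t = 0.
Proof.
rewrite mul_mx_row -[X in _ = X](row_mx0 _ _ _) => /eq_row_mx[u1 u2].
have um : below m u.
  move=> x le_mx; have /rowP/(_ x) := u2; rewrite !mxE (bigD1 x) //= mxE eqxx le_mx.
  rewrite mulr1 big1 ?addr0 // => y ne; rewrite mxE (negPf ne) andbF mulr0 //.
split=> //; apply/rowP => c; have /rowP/(_ c) := u1; rewrite !mxE => E.
rewrite -[RHS]E; apply: eq_bigr => x _; rewrite [in RHS]mxE; case: ltnP => // /um ->.
by rewrite !mul0r.
Qed.

(** Repetitions in [f] are allowed; they only give singular matrices. *)
Definition minor m (f : {ffun 'I_N -> 'I_(C + N)}) t : 'M[k]_N := colsub f (kermat m t).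

Lemma polmx_kermat m : polmx (kermat m).
Proof.
move=> x j; rewrite -[j]splitK; case: (split j) => c /=.
  under eq_fun do rewrite row_mxEl !mxE; case: ltnP => _; last exact: pol_cst.
  exact: pol_coord.
by under eq_fun do rewrite row_mxEr mxE; apply: pol_cst.
Qed.

Lemma polmx_minor m f : polmx (minor m f).
Proof. by move=> x y; under eq_fun do rewrite mxE; apply: polmx_kermat. Qed.

Lemma minor_unit_free m f t : minor m f t \in unitmx ->
  forall u : 'rV_N, u *m kermat m t = 0 -> u = 0.
Proof.
move=> mu_ u u0; have uM : u *m minor m f t = 0.
  by rewrite /minor mulmx_colsub u0; apply/matrixP => x y; rewrite !mxE.
by rewrite -(mulmxK mu_ u) uM mul0mx.
Qed.

Lemma free_minor_unit m t : (forall u : 'rV_N, u *m kermat m t = 0 -> u = 0) ->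
  exists f, minor m f t \in unitmx.
Proof.
move=> free; have fA : row_free (kermat m t).
  by apply/inj_row_free => u /free.
have fA' : row_full (kermat m t)^T by rewrite /row_full mxrank_tr.
exists (finfun (fullrankfun fA')).
have := fullrowsub_unit fA'; rewrite -unitmx_tr; congr (_ \in unitmx).
by apply/matrixP => x y; rewrite /minor [RHS]mxE ffunE [LHS]mxE [LHS]mxE [LHS]mxE.
Qed.

(** For empty [S], [supp_in S] means being zero, so [socle_step] for the transposed matrices gives a
    nonzero vector killed by all arrows. *)
Lemma nil_kernel t : (0 < N)%N -> nil t -> exists2 u : 'rV_N, u != 0 & u *m stack t = 0.
Proof.
move=> N0 [_ /tr_nil_tr tn].
have [||u u0 ut] := socle_step (S := finset.set0) tn.
- by exists (Ordinal N0); rewrite finset.inE.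
- move=> a u Su; suff -> : u = 0 by rewrite mul0mx => x _; rewrite mxE.
  by apply/rowP => x; rewrite Su ?mxE // finset.inE.
exists u.
  by apply: contra_not_neq u0 => -> x _; rewrite mxE.
apply/rowP => c; rewrite mul_stack [RHS]mxE.
have := ut (enum_val c).1 (enum_val c).2; rewrite finset.inE => /(_ isT) E.
by rewrite -[RHS]E mxE; apply: eq_bigr => x _; rewrite !mxE.
Qed.

Section Pivot.
Variables (t : mat_coord -> k) (m : 'I_N) (f : {ffun 'I_N -> 'I_(C + N)}).
Hypothesis st : block_support blk [set: 'I_N]%SET t.
Hypothesis m_free : minor m f t \in unitmx.
Hypothesis m_dep : exists2 u : 'rV_N, u != 0 & u *m kermat m.+1 t = 0.

(** If [w] lies below [m] and [e_m + w] is in the kernel, then [w *m kermat m t] is minus row [m] of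
    the stack, padded by zeros; the columns chosen by [f] suffice to solve for [w]. *)
Definition pivot_vec t : 'rV[k]_N :=
  - colsub f (row_mx (row m (stack t)) 0) *m invmx (minor m f t).

Lemma pivot_vec_uniq w : below m w -> (delta_mx 0 m + w) *m stack t = 0 ->
  w = pivot_vec t.
Proof.
move=> bw /eqP; rewrite mulmxDl -rowE addrC addr_eq0 => /eqP wt.
rewrite /pivot_vec -[LHS](mulmxK m_free) mulmx_colsub mul_kermat_below // wt.
congr (_ *m _); apply/matrixP => x y; rewrite !mxE.
by case: split => j; rewrite !mxE ?oppr0.
Qed.

(** A kernel vector from [m_dep] has a nonzero coefficient at [m], as otherwise [m_free] would make
    it zero; after normalization, uniqueness identifies it. *)
Lemma pivot_vecP : below m (pivot_vec t) /\
  (delta_mx 0 m + pivot_vec t) *m stack t = 0.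
Proof.
have [u u0 /ker_kermat[bu ut]] := m_dep.
have um : u 0 m != 0.
  apply: contraNneq u0 => um; apply/eqP/(minor_unit_free m_free).
  rewrite mul_kermat_below ?ut ?row_mx0 // => x.
  by rewrite leq_eqVlt => /orP[/eqP/val_inj <- //|/bu].
pose w := (u 0 m)^-1 *: u - delta_mx 0 m.
suff [bw wt] : below m w /\ (delta_mx 0 m + w) *m stack t = 0.
  by rewrite -(pivot_vec_uniq bw wt).
split; last by rewrite /w addrC subrK -scalemxAl ut scaler0.
move=> x; rewrite leq_eqVlt => /orP[/eqP/val_inj <-|lt_mx].
  by rewrite !mxE !eqxx mulVf // subrr.
by rewrite !mxE (bu x) // mulr0 sub0r eqxx /=; case: eqP lt_mx => [->|]; rewrite ?ltnn ?oppr0.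
Qed.

(** The common kernel is graded, so projecting to the block of [m] gives another solution, which
    uniqueness identifies with the first. *)
Lemma pivot_vec_block x : blk x != blk m -> pivot_vec t 0 x = 0.
Proof.
have [bw wt] := pivot_vecP; set w := pivot_vec t in bw wt *.
suff -> : w = w *m blkE k blk (blk m) by move=> /negPf xm; rewrite blkE_row xm mulr0.
apply/esym/pivot_vec_uniq => [y /bw wy|]; first by rewrite blkE_row wy mul0r.
have -> : delta_mx 0 m + w *m blkE k blk (blk m) = (delta_mx 0 m + w) *m blkE k blk (blk m).
  rewrite mulmxDl; congr (_ + _); apply/rowP => y; rewrite blkE_row !mxE eqxx /=.
  by case: eqP => [->|_]; rewrite ?eqxx ?mulr1 // mul0r.
apply/rowP => c; rewrite mul_stack [RHS]mxE.
(* An arrow starting at the block of [m] sees only that block; any other arrow kills it. *)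
have [mE|ne] := eqVneq (blk m) (src (enum_val c).1).
  have /rowP/(_ c) := wt; rewrite mul_stack mxE => {2}<-.
  apply: eq_bigr => y _; rewrite blkE_row.
  have [_|ne] := eqVneq (blk y) (blk m); first by rewrite mulr1.
  by rewrite st ?mulr0 // -mE (negPf ne) !andbF.
apply: big1 => y _; rewrite blkE_row; have [ym|_] := eqVneq (blk y) (blk m).
  by rewrite st ?mulr0 // ym (negPf ne) !andbF.
by rewrite mulr0 mul0r.
Qed.

End Pivot.

Lemma mulmx_eq_col n p q (A : 'M[k]_(n, p)) (M M' : 'M_(p, q)) x y :
  (forall l, M l y = M' l y) -> (A *m M) x y = (A *m M') x y.
Proof. by move=> E; rewrite !mxE; apply: eq_bigr => l _; rewrite E. Qed.

(* The kernel vector with leading term [e_m] is unique and regular on [B]. *)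
Lemma mu_add_pivot (B : set (mat_coord -> k)) (m : 'I_N) f T :
  basic B -> (forall t, B t -> block_support blk [set: 'I_N]%SET t) ->
  (forall t, B t -> minor m f t \in unitmx) ->
  (forall t, B t -> exists2 u : 'rV_N, u != 0 & u *m kermat m.+1 t = 0) ->
  m \notin T ->
  mu (kernel_frames blk (m |: T)%SET B) = mu (kernel_frames blk T B).
Proof.
move=> bB sB uB dB mT.
have frE (z z' : pair_coord Q N -> k) y : (forall x, z (inr (x, y)) = z' (inr (x, y))) ->
    forall l, frame_of z l y = frame_of z' l y.
  by move=> E l; rewrite !mxE E.
have stackE z a x : (mat (tpart z) a *m frame_of z) x m =
    ((delta_mx 0 m + \row_y z (inr (y, m))) *m stack (tpart z)) 0 (enum_rank (a, x)).
  rewrite mul_stack mxE enum_rankK; apply: eq_bigr => y _.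
  by rewrite !mxE eqxx mulrC.
have lowE x y : y != m -> low blk (m |: T)%SET x y = low blk T x y.
  by move=> ym; rewrite /low finset.in_setU1 (negPf ym).
have pivot_kernel z : kernel_frames blk (m |: T)%SET B z ->
    \row_y z (inr (y, m)) = pivot_vec m f (tpart z).
  move=> [Bz lz kz]; apply: pivot_vec_uniq; first exact: uB.
    by move=> x le_mx; rewrite mxE lz // /low ltnNge le_mx andbF.
  apply/rowP => c; rewrite -[c]enum_valK; case: (enum_val c) => a x.
  by rewrite -stackE kz ?mxE // finset.setU11.
(* Erasing column [m] of the frame is undone by filling in the pivot vector, which depends on the
   representation alone. *)
apply: (@mu_iso _ _ _ _ _
  (fun z c => if c is inr (x, y) then if y == m then 0 else z (inr (x, y)) else z c)
  (fun z c => if c is inr (x, y) then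
     if y == m then pivot_vec m f (tpart z) 0 x else z (inr (x, y)) else z c)).
- exact: basic_kernel_frames.
- exact: basic_kernel_frames.
- move=> z Kz; have [Bz lz kz] := Kz; split; last first.
    apply/funext => -[//|[x y]]; case: eqP => // ->.
    by rewrite [tpart _](_ : _ = tpart z) // -pivot_kernel // mxE.
  split=> //.
    by move=> x y out; case: ifP => // /negbT ym; rewrite lz // lowE.
  move=> a x y yT; have ym : y != m by apply: contraNneq mT => <-.
  rewrite (mulmx_eq_col _ (M' := frame_of z)); last first.
    by apply: frE => l; rewrite (negPf ym).
  by apply: kz; rewrite finset.in_setU1 yT orbT.
- move=> z [Bz lz kz]; split; last first.
    apply/funext => -[//|[x y]]; case: eqP => // ->.
    by rewrite lz // /low (negPf mT).
  have sz := sB _ Bz; have uz := uB _ Bz; have dz := dB _ Bz.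
  have [bp pP] := pivot_vecP uz dz.
  split=> //.
    move=> x y; case: eqP => [->|/eqP ym]; last by rewrite lowE //; apply: lz.
    rewrite /low finset.setU11 /= negb_and -leqNgt => /orP[/bp //|].
    exact: pivot_vec_block.
  move=> a x y; rewrite finset.in_setU1 => /orP[/eqP ->|yT].
    rewrite stackE; set w := \row_y' _; have -> : w = pivot_vec m f (tpart z).
      by apply/rowP => l; rewrite mxE eqxx.
    by rewrite -[stack (tpart _)]/(stack (tpart z)) pP mxE.
  have ym : y != m by apply: contraNneq mT => <-.
  rewrite (mulmx_eq_col _ (M' := frame_of z)); last first.
    by apply: frE => l; rewrite (negPf ym).
  exact: kz.
- case=> [c|[x y]]; first exact/rat_pol/pol_coord.
  by case: (y == m); apply: rat_pol; [exact: pol_cst | exact: pol_coord].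
- case=> [c|[x y]]; first exact/rat_pol/pol_coord.
  case: (y == m); last exact/rat_pol/pol_coord.
  rewrite /pivot_vec; apply: ratmx_mul; last first.
    apply: ratmx_inv => [|z [Bz _ _]]; last exact: uB.
    move=> i j; apply: (pol_comp (polmx_minor m f i j)) => c; exact: pol_coord.
  apply: ratmx_pol => i j; under eq_fun do rewrite !mxE.
  apply: polN; case: split => c; last by under eq_fun do rewrite mxE; apply: pol_cst.
  by under eq_fun do rewrite !mxE; apply: pol_coord.
Qed.

Definition alternating_sum (B : set (mat_coord -> k)) : K0 k :=
  \sum_(T : {set 'I_N}) (-1) ^+ #|T| * mu (kernel_frames blk T B).

Lemma alternating_sum_split B h : basic B -> pol h -> alternating_sum B =
  alternating_sum (B `&` [set t | h t = 0]) + alternating_sum (B `&` [set t | h t != 0]).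
Proof.
move=> bB ph; rewrite /alternating_sum -big_split /=; apply: eq_bigr => T _.
rewrite -mulrDr; congr (_ * _).
have pt : pol (fun z => h (tpart z : mat_coord -> k)).
  by apply: pol_comp ph _ => c; apply: pol_coord.
have E P : kernel_frames blk T (B `&` P) =
    kernel_frames blk T B `&` [set z | P (tpart z)].
  by apply/seteqP; split=> z; [case=> -[Bz Pz] lz kz | case=> -[Bz lz kz] Pz]; split.
by rewrite !E; apply: mu_split => //; apply: basic_kernel_frames.
Qed.

Definition constant_sign (B : set (mat_coord -> k)) h :=
  (forall t, B t -> h t = 0) \/ (forall t, B t -> h t != 0 :> k).

(** Minors of constant sign make [dep m] agree at all points of [B], so a pivot found at one point
    [t0] serves for all. The bound [m = N] is included because the pivot may be the last basis
    vector. *)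
Lemma alternating_sum_stratum B : (0 < N)%N -> basic B -> B `<=` nil ->
  (forall (m : 'I_N.+1) f, constant_sign B (fun t => \det (minor m f t))) ->
  alternating_sum B = 0.
Proof.
move=> N0 bB nB cB; have [[t0 Bt0]|Bempty] := pselect (exists t, B t); last first.
  apply: big1 => T _; rewrite mu_empty ?mulr0 //; first exact: basic_kernel_frames.
  by move=> z [Bz _ _]; apply: Bempty; exists (tpart z).
pose dep m t := exists2 u : 'rV_N, u != 0 & u *m kermat m t = 0.
have unitE (m : 'I_N.+1) t : B t -> (dep m t <-> dep m t0).
  have half t1 t2 : B t1 -> B t2 -> dep m t1 -> dep m t2.
    move=> B1 B2 [u u0 um]; apply: contrapT => ndep.
    have [|f] := @free_minor_unit m t2.
      move=> v v0; apply: contrapT => /eqP vn; apply: ndep; by exists v.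
    rewrite unitmxE unitfE => f2; have f1 : \det (minor m f t1) != 0.
      by case: (cB m f) => [/(_ _ B2) E|/(_ _ B1) //]; rewrite E eqxx in f2.
    by move/eqP: u0; apply; apply: minor_unit_free um; rewrite unitmxE unitfE; exact: f1.
  by move=> Bt; split; apply: half.
(* At the bound [N] every kernel vector counts, and [nil_kernel] provides a nonzero one. *)
have exm : exists m, (m < N)%N && `[< dep m.+1 t0 >].
  exists N.-1; rewrite prednK // leqnn; apply/asboolP.
  have [u u0 ut] := nil_kernel N0 (nB _ Bt0); exists u => //.
  rewrite mul_kermat_below ?ut ?row_mx0 // => x; rewrite leqNgt ltn_ord //.
case: (ex_minnP exm) => m /andP[ltmN /asboolP dep_m] min_m.
(* For [m = 0] only the zero vector lies below [m]; otherwise minimality applies to the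
   predecessor. *)
have nodep : ~ dep m t0.
  case: m ltmN dep_m min_m => [|m] ltmN _ min_m dep_m.
    have [u /eqP u0 /ker_kermat[u1 _]] := dep_m; apply: u0.
    by apply/rowP => x; rewrite u1 // mxE.
  have := min_m m; rewrite (ltnW ltmN) ltnn => H.
  by have := H (introT (asboolP _) dep_m).
have [f f0] : exists f, minor m f t0 \in unitmx.
  apply: free_minor_unit => v v0; apply: contrapT => /eqP vn; apply: nodep.
  by exists v.
have uB t : B t -> minor m f t \in unitmx.
  move: f0; rewrite !unitmxE !unitfE => f0 Bt.
  have [/(_ _ Bt0) E|/(_ _ Bt) //] := cB (Ordinal (ltnW ltmN : m < N.+1)%N) f.
  by rewrite E eqxx in f0.
pose mm := Ordinal ltmN.
rewrite /alternating_sum.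
transitivity (\sum_(T : {set 'I_N} | T \subset mm |: ~: [set mm]%SET)
    (-1) ^+ #|T| * mu (kernel_frames blk T B)).
  by apply: eq_bigl => T; rewrite finset.setUCr finset.subsetT.
rewrite big_setU1_split; last by rewrite !finset.inE eqxx.
apply: big1 => T TS; have mT : mm \notin T.
  by apply/negP => /(fintype.subsetP TS); rewrite !finset.inE eqxx.
rewrite (@mu_add_pivot B mm f T) //.
- by rewrite cardsU1 mT exprS mulN1r mulNr subrr.
- by move=> t /nB[].
- move=> t Bt; have [_] := unitE (Ordinal (ltmN : m.+1 < N.+1)%N) t Bt; exact.
Qed.

(** Cuts successively by each of the finitely many minors; [s] lists those whose sign may still vary
    on [B]. *)
Lemma alternating_sum0 : (0 < N)%N -> alternating_sum nil = 0.
Proof.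
move=> N0; pose idx : finType := ('I_N.+1 * {ffun 'I_N -> 'I_(C + N)})%type.
pose h (i : idx) t := \det (minor i.1 i.2 t).
suff main (s : seq idx) B : basic B -> B `<=` nil ->
    (forall i, i \notin s -> constant_sign B (h i)) -> alternating_sum B = 0.
  by apply: (main (enum idx)) => // [|i]; [exact: basic_nil_mat | rewrite mem_enum].
elim: s B => [|i s IH] B bB nB cB.
  by apply: alternating_sum_stratum => // m f; apply: (cB (m, f)).
have ph : pol (h i) by apply/polmx_det/polmx_minor.
rewrite (alternating_sum_split bB ph) !IH ?addr0 //.
- exact/basicI/basic_neq0.
- by move=> t [/nB].
- move=> j js; have [->|ji] := eqVneq j i; first by right=> t [].
  by case: (cB j) => [|H|H]; [rewrite inE negb_or ji | left=> t [/H] | right=> t [/H]].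
- exact/basicI/basic_eq0.
- by move=> t [/nB].
- move=> j js; have [->|ji] := eqVneq j i; first by left=> t [].
  by case: (cB j) => [|H|H]; [rewrite inE negb_or ji | left=> t [/H] | right=> t [/H]].
Qed.

End KernelVectors.

(** * The q-binomial theorem *)

Section EvalInt.
Variables (A : comPzRingType) (x : A).
Implicit Types p q : {poly int}.

Lemma eval_int_wide n p : (size p <= n)%N ->
  eval_int p x = \sum_(i < n) x ^+ i *~ p`_i.
Proof.
move=> le_pn; rewrite /eval_int (big_ord_widen n (fun i => x ^+ i *~ p`_i)) //.
rewrite big_mkcond; apply: eq_bigr => i _; case: ltnP => // le_pi.
by rewrite nth_default // mulr0z.
Qed.

Lemma eval_intD p q : eval_int (p + q) x = eval_int p x + eval_int q x.
Proof.
rewrite (eval_int_wide (size_polyD p q)) !(@eval_int_wide (maxn (size p) (size q)));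
  rewrite ?leq_maxl ?leq_maxr // -big_split /=.
by apply: eq_bigr => i _; rewrite coefD mulrzDr.
Qed.

Lemma eval_intC c : eval_int c%:P x = c%:~R.
Proof. by rewrite (eval_int_wide (size_polyC_leq1 c)) big_ord1 coefC. Qed.

Lemma eval_intMC c p : eval_int (c%:P * p) x = eval_int p x *~ c.
Proof.
rewrite mul_polyC (eval_int_wide (size_scale_leq c p)) /eval_int mulrz_suml.
by apply: eq_bigr => i _; rewrite coefZ mulrC mulrzA.
Qed.

Lemma eval_intMX p : eval_int (p * 'X) x = eval_int p x * x.
Proof.
rewrite (@eval_int_wide (size p).+1) ?(leq_trans (size_polyMleq _ _)) ?size_polyX ?addn2 //.
rewrite big_ord_recl coefMX eqxx mulr0z add0r mulr_suml.
by apply: eq_bigr => i _; rewrite coefMX /= exprSr mulrzAl.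
Qed.

Lemma eval_intM p q : eval_int (p * q) x = eval_int p x * eval_int q x.
Proof.
elim/poly_ind: p q => [|p c IH] q.
  by rewrite mul0r -polyC0 eval_intC mul0r.
rewrite mulrDl eval_intD eval_intMC -mulrA [_ * q]mulrC IH eval_intMX.
rewrite eval_intD eval_intMX eval_intC mulrDl -mulrA [_ * x]mulrC.
by congr (_ + _); rewrite mulrzl.
Qed.

Lemma eval_intXn n : eval_int 'X^n x = x ^+ n.
Proof.
elim: n => [|n IH]; first by rewrite expr0 -polyC1 eval_intC.
by rewrite !exprSr eval_intMX IH.
Qed.

Lemma eval_int_sum (J : Type) (r : seq J) (P : pred J) (F : J -> {poly int}) :
  eval_int (\sum_(j <- r | P j) F j) x = \sum_(j <- r | P j) eval_int (F j) x.
Proof.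
by apply: (big_morph _ eval_intD); rewrite -polyC0 eval_intC.
Qed.

End EvalInt.

Section QuantumBinomial.

(* The elementary symmetric polynomial of degree [k] in 1, q, ..., q^(n-1). *)
Fixpoint qesym n k : {poly int} := match n, k with
  | _, 0 => 1
  | 0, _.+1 => 0
  | n'.+1, k'.+1 => qesym n' k + 'X^n' * qesym n' k'
  end.

Lemma qesym0 n : qesym n 0 = 1.
Proof. by case: n. Qed.

Lemma qesym_gt n k : (n < k)%N -> qesym n k = 0.
Proof.
elim: n k => [|n IH] [|k] //= lt_nk; rewrite !IH ?mulr0 ?addr0 //.
exact: ltnW.
Qed.

Lemma qesymS n k : qesym n.+1 k =
  qesym n k + (if k is k'.+1 then 'X^n * qesym n k' else 0).
Proof. by case: k => [|k] //=; rewrite qesym0 addr0. Qed.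

(** The q-binomial theorem in coefficient form, free of division. The induction rests on $1-q^{n+1}
    = (1-q^{n-k}) + q^{n-k}(1-q^{k+1})$. *)
Lemma qesym_fact n k : (k <= n)%N ->
  qesym n k * (qfact k * qfact (n - k)) = 'X^('C(k, 2)) * qfact n.
Proof.
elim: n k => [|n IH] [|k] //= le_kn.
- by rewrite subnn !qfact0 bin0n !mulr1.
- by rewrite subn0 qfact0 bin0n !mul1r.
have E1 := IH k le_kn; rewrite subSS binS bin1 exprD.
(* For [k = n] the truncated [n - k.+1] would break the recursion of [qfact (n - k)]. *)
have [nk|ne] := eqVneq k n.
  move: E1; rewrite -nk => E1;
  rewrite qesym_gt // add0r qfactS; rewrite subnn qfact0 !mulr1 in E1 *.
  transitivity ('X^k * (1 - 'X^(k.+1)) * (qesym k k * qfact k)); first by ring.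
  by rewrite E1; ring.
have lt_kn : (k < n)%N by rewrite ltn_neqAle ne.
have E2 := IH k.+1 lt_kn; move: E2; rewrite binS bin1 exprD => E2.
have EQ : qfact (n - k) = qfact (n - k.+1) * (1 - 'X^(n - k)).
  by rewrite -(subnSK lt_kn) qfactS.
have EX : 'X^n = 'X^k * 'X^(n - k) :> {poly int} by rewrite -exprD subnKC.
transitivity (qesym n k.+1 * (qfact k.+1 * qfact (n - k.+1)) * (1 - 'X^(n - k))
   + 'X^n * (1 - 'X^(k.+1)) * (qesym n k * (qfact k * qfact (n - k)))).
  by rewrite EQ qfactS; ring.
by rewrite E1 E2 qfactS !exprS EX; ring.
Qed.

Lemma qfact_neq0 n : qfact n != 0.
Proof.
by rewrite -lead_coef_eq0; apply: contraTneq (qfact_lead n) => ->; rewrite unitr0.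
Qed.

Lemma qesymE n k : (k <= n)%N -> qesym n (n - k) = 'X^('C(n - k, 2)) * qbinom n k.
Proof.
move=> le_kn; apply: (@mulIf _ (qfact (n - k) * qfact (n - (n - k)))).
  by rewrite mulf_neq0 ?qfact_neq0.
rewrite qesym_fact ?leq_subr // -mulrA subKn //; congr (_ * _).
by rewrite [qfact _ * _]mulrC qbinomE.
Qed.

End QuantumBinomial.

(** * Subsets with prescribed block sizes *)

Section SubsetSum.
Variables (V : finType) (N : nat) (blk : 'I_N -> V).
Implicit Types T : {set 'I_N}.

Definition block_card T i := #|[set x in T | blk x == i]%SET|.
(** The number of free coefficients of a vector with leading term [e_y]; on a block of size $n$ it
    takes the values $0, \ldots, n-1$. *)
Definition rank_in_block (y : 'I_N) := #|[set x : 'I_N | (x < y)%N & blk x == blk y]%SET|.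

Lemma block_cardE T i : block_card T i = (\sum_(x in T) (blk x == i))%N.
Proof.
rewrite /block_card -sum1_card big_mkcond [RHS]big_mkcond /=; apply: eq_bigr => x _.
by rewrite finset.inE; case: (x \in T); case: (_ == _).
Qed.

Lemma sum_block_card T : (\sum_i block_card T i)%N = #|T|.
Proof.
under eq_bigr do rewrite block_cardE; rewrite exchange_big -sum1_card.
apply: eq_bigr => x _; rewrite (bigD1 (blk x)) //= eqxx big1 // => i ne.
by rewrite eq_sym (negPf ne).
Qed.

(** In block [i] one sums products of [c i] distinct powers among $1, q, q^2, \ldots$, hence an
    elementary symmetric polynomial. The induction adds the basis vectors in increasing order. *)
Lemma sum_subsets (c : V -> nat) :
  \sum_(T : {set 'I_N} | [forall i, block_card T i == c i])
     'X^(\sum_(y in T) rank_in_block y)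
  = \prod_i qesym (block_card [set: 'I_N]%SET i) (c i).
Proof.
pose A m : {set 'I_N} := [set x : 'I_N | (x < m)%N]%SET.
pose w c T : {poly int} := if [forall i, block_card T i == c i]
  then 'X^(\sum_(y in T) rank_in_block y) else 0.
suff main m : (m <= N)%N ->
    \sum_(T : {set 'I_N} | T \subset A m) w c T
    = \prod_i qesym (block_card (A m) i) (c i).
  have AN : A N = [set: 'I_N]%SET by apply/setP => x; rewrite !finset.inE ltn_ord.
  rewrite -AN -main // big_mkcond [RHS]big_mkcond; apply: eq_bigr => T _.
  by rewrite AN finset.subsetT.
elim: m c => [|m IH] c ltmN.
  have A0 : A 0%N = finset.set0 by apply/setP => x; rewrite !finset.inE.
  rewrite A0 (big_pred1 finset.set0) => [|T]; last by rewrite finset.subset0.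
  have b0 i : block_card finset.set0 i = 0%N by rewrite block_cardE big_set0.
  rewrite /w; case: ifP => [/forallP c0|/negbT].
    rewrite big_set0 expr0 big1 // => i _; have /eqP := c0 i.
    by rewrite b0 => <-.
  rewrite negb_forall => /existsP[l]; rewrite b0 => cl.
  by rewrite (bigD1 l) //= b0; case: (c l) cl => //= n _; rewrite mul0r.
pose mm := Ordinal ltmN; pose j := blk mm.
have AS : A m.+1 = (mm |: A m)%SET.
  by apply/setP => x; rewrite !finset.inE ltnS leq_eqVlt.
have mA : mm \notin A m by rewrite finset.inE ltnn.
have bU T i : T \subset A m -> block_card (mm |: T)%SET i = ((j == i) + block_card T i)%N.
  move=> /fintype.subsetP TA; have mT : mm \notin T by apply: contra mA => /TA.
  by rewrite !block_cardE big_setU1.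
have rE : rank_in_block mm = block_card (A m) j.
  by apply: eq_card => x; rewrite !finset.inE.
rewrite AS big_setU1_split // big_split /= IH 1?ltnW //.
rewrite (bigD1 j) //= [RHS](bigD1 j) //= bU // eqxx add1n qesymS mulrDl; congr (_ + _).
  by congr (_ * _); apply: eq_bigr => i ne; rewrite bU // eq_sym (negPf ne).
case cj : (c j) => [|n].
  rewrite mul0r big1 // => T TA; rewrite /w; case: ifP => // /forallP/(_ j).
  by rewrite bU // eqxx cj.
(* The chosen [mm] uses up one element of its block [j]. *)
pose c' i := if i == j then n else c i.
transitivity ('X^(rank_in_block mm) * \sum_(T : {set 'I_N} | T \subset A m) w c' T).
  rewrite big_distrr /=; apply: eq_bigr => T TA; rewrite /w.
  have -> : [forall i, block_card (mm |: T)%SET i == c i] =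
            [forall i, block_card T i == c' i].
    apply: eq_forallb => i; rewrite bU // /c' (eq_sym j).
    by case: (eqVneq i j) => [->|_] //; rewrite cj.
  case: ifP => _; last by rewrite mulr0.
  rewrite big_setU1 ?exprD //; apply: contra mA.
  by move/fintype.subsetP: TA => /(_ mm).
rewrite IH 1?ltnW // rE (bigD1 j) //= /c' eqxx -!mulrA; congr (_ * (_ * _)).
apply: eq_bigr => i ne; rewrite (negPf ne) bU // eq_sym (negPf ne) //.
Qed.

End SubsetSum.

(** * The recursion *)

Section Recursion.
Variables (Q : quiver) (k : numClosedFieldType).
Implicit Types d : dimvec Q.

Local Notation L := (Lefschetz k).
Local Notation cl d := (K0_class (nullcone_variety k d)).

Lemma dimvec_of_le d (e : subdim d) i : (dimvec_of e i <= d i)%N.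
Proof. by rewrite ffunE -ltnS; apply: ltn_ord. Qed.

Definition recursion_term d (e : subdim d) : K0 k :=
  (-1) ^+ (total_dim d - total_dim (dimvec_of e))%N
  * L ^+ `|recursion_exp d (dimvec_of e)|%N
  * eval_int (qbinom_dim d (dimvec_of e)) L * cl (dimvec_of e).

(** Groups the vanishing alternating sum by the dimension vector [e] of the complement of [T].
    Within a group only the sum of the ranks varies, and [sum_subsets] evaluates it. *)
Lemma sum_recursion_term d : d <> [ffun=> 0%N] ->
  \sum_(e : subdim d) recursion_term e = 0.
Proof.
move=> dn0; pose N := #|{: {i : vertex Q & 'I_(d i)}}|.
pose blk (x : 'I_N) : vertex Q := tag (enum_val x).
have bT i : block_card blk [set: 'I_N]%SET i = d i.
  pose r (p : 'I_(d i)) : 'I_N := enum_rank (Tagged (fun j => 'I_(d j)) p).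
  have r_inj : injective r by move=> p q /enum_rank_inj /eqP; rewrite eq_Tagged => /eqP.
  rewrite /block_card -[RHS]card_ord -(card_imset _ r_inj); apply: eq_card => x.
  rewrite !finset.inE /blk; apply/eqP/imsetP => [xi|[p _ ->]]; last by rewrite enum_rankK.
  by move: (enum_valK x) xi; case: (enum_val x) => j p /= <- ji; subst j; exists p.
have N0 : (0 < N)%N.
  rewrite lt0n; apply/negP => /eqP N0; apply: dn0; apply/ffunP => i.
  rewrite ffunE -bT block_cardE big1 // => x _.
  by have := ltn_ord x; rewrite [ltnRHS]N0.
have bC (T : {set 'I_N}) i : (block_card blk T i + block_card blk (~: T)%SET i)%N = d i.
  rewrite -bT !block_cardE [RHS](bigID (mem T)) /=.
  by congr (_ + _)%N; apply: eq_bigl => x; rewrite !finset.inE.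
(* The default of [inord] never occurs: block sizes are bounded by [d]. *)
pose e_of (T : {set 'I_N}) : subdim d :=
  [ffun i => inord (block_card blk (~: T)%SET i)].
have e_ofE T i : dimvec_of (e_of T) i = block_card blk (~: T)%SET i.
  by rewrite ffunE /= ffunE inordK // ltnS -(bC T) leq_addl.
rewrite -[RHS](alternating_sum0 k blk N0) /alternating_sum.
rewrite [RHS](partition_big e_of xpredT) //=; apply: eq_bigr => e _.
pose c i := (d i - dimvec_of e i)%N.
have cP (T : {set 'I_N}) : (e_of T == e) = [forall i, block_card blk T i == c i].
  apply/eqP/forallP => [eT i|H].
    by rewrite /c -eT e_ofE -(bC T) addnK.
  apply/ffunP => i; apply/val_inj; have := e_ofE T i; rewrite ffunE => ->.
  have := bC T i; have /eqP -> := H i; rewrite /c -[in RHS](subnK (dimvec_of_le e i)).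
  by move/addnI ->; rewrite ffunE.
transitivity (\sum_(T : {set 'I_N} | e_of T == e)
    (-1) ^+ (total_dim d - total_dim (dimvec_of e)) * cl (dimvec_of e)
    * L ^+ (\sum_a dimvec_of e (src a) * (d (tgt a) - dimvec_of e (tgt a)))
    * eval_int 'X^(\sum_(y in T) rank_in_block blk y) L).
  rewrite -big_distrr -eval_int_sum (eq_bigl _ _ cP) sum_subsets.
  rewrite (eq_bigr (fun i => 'X^('C(c i, 2)) * qbinom (d i) (dimvec_of e i))); last first.
    by move=> i _; rewrite bT qesymE // dimvec_of_le.
  rewrite big_split /= -/(qbinom_dim _ _) eval_intM -expr_sum eval_intXn.
  rewrite /recursion_term recursion_expE; last exact: dimvec_of_le.
  rewrite absz_nat exprD; set s := (-1) ^+ _; set q := eval_int _ _.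
  set u := L ^+ _; set v := L ^+ _; set n := cl _.
  by rewrite -!mulrA; congr (_ * _); rewrite [RHS]mulrC -!mulrA mulrCA.
apply: eq_bigr => T /eqP eT.
rewrite mu_kernel_frames mu_split_frames card_free_coord exprD eval_intXn.
have -> : mu (nil_mat (k := k) blk (~: T)%SET) = cl (dimvec_of e).
  by apply/esym/nullcone_mu => i; rewrite -eT e_ofE.
have cT : (total_dim d - total_dim (dimvec_of e))%N = #|T|.
  rewrite /total_dim -(sum_block_card blk T) -eT.
  rewrite -[X in (X - _)%N](eq_bigr _ (fun i _ => bC T i)) big_split /=.
  by rewrite (eq_bigr _ (fun i _ => e_ofE T i)) addnK.
rewrite cT -!mulrA; congr (_ * (_ * (_ ^+ _ * _))).
apply: eq_bigr => a _; rewrite mulnC -eT !e_ofE -/(block_card blk _ _).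
by rewrite -(bC T (tgt a)) addnK.
Qed.

Lemma recursion_term_top d (e : subdim d) : dimvec_of e = d -> recursion_term e = cl d.
Proof.
move=> eE; rewrite /recursion_term eE subnn recursion_expE //.
rewrite big1 => [|i _]; last by rewrite subnn.
rewrite big1 => [|a _]; last by rewrite subnn muln0.
rewrite /qbinom_dim big1 => [|i _]; first by rewrite -polyC1 eval_intC !mul1r.
(* In degree 0, [qesymE] says that [qbinom n n] is 1. *)
by have := @qesymE (d i) (d i) (leqnn _); rewrite subnn qesym0 bin0n expr0 mul1r.
Qed.

Lemma nullcone_recursion d : d <> [ffun=> 0%N] ->
  cl d = - \sum_(e : subdim d | dimvec_of e != d) recursion_term e.
Proof.
move=> dn0; apply/eqP; rewrite -addr_eq0; apply/eqP.
rewrite -[RHS](sum_recursion_term dn0) [RHS](bigID (fun e => dimvec_of e == d)) /=.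
congr (_ + _); pose top : subdim d := [ffun i => ord_max].
rewrite (big_pred1 top) => [|e].
  by rewrite recursion_term_top //; apply/ffunP => i; rewrite !ffunE.
apply/eqP/eqP => [eE|->]; last by apply/ffunP => i; rewrite !ffunE.
apply/ffunP => i; apply/val_inj; rewrite ffunE /=.
by move/ffunP/(_ i): eE; rewrite ffunE.
Qed.

(** All traces are empty sums, so the nullcone is the whole affine space of representations. *)
Lemma nullcone0 : exists p : {poly int}, cl ([ffun=> 0%N] : dimvec Q) = eval_int p L.
Proof.
pose d0 : dimvec Q := [ffun=> 0%N].
exists 'X^(#|{: rep_coord d0}|); rewrite eval_intXn -K0_affine -mu_affine nullcone_mu_rep.
congr mu; apply/seteqP; split=> // x _ w _; apply: big1 => y _.
by case: (enum_val y) => i [m]; rewrite ffunE.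
Qed.

(** Strong induction on the total dimension, which drops strictly in every term of the recursion. *)
Lemma nullcone_polynomial d : exists p : {poly int}, cl d = eval_int p L.
Proof.
have [n] := ubnP (total_dim d); elim: n d => // n IH d; rewrite ltnS => le_dn.
have [->|/eqP dn0] := eqVneq d [ffun=> 0%N]; first exact: nullcone0.
pose isp (a : K0 k) := exists p : {poly int}, a = eval_int p L.
have ispN a : isp a -> isp (- a).
  by move=> [p ->]; exists ((-1)%:P * p); rewrite eval_intMC mulrN1z.
have ispM a b : isp a -> isp b -> isp (a * b).
  by move=> [p ->] [q ->]; exists (p * q); rewrite eval_intM.
rewrite nullcone_recursion //; apply: (ispN).
elim/big_ind: _ => [|_ _ [p ->] [q ->]|e ne].
- by exists 0; rewrite -polyC0 eval_intC.
- by exists (p + q); rewrite eval_intD.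
apply: (ispM); last first.
  apply: IH; apply: leq_trans le_dn; have [l el] : exists l, dimvec_of e l != d l.
    apply/existsP; rewrite -negb_forall; apply: contra ne => /forallP E.
    by apply/eqP/ffunP => l; apply/eqP.
  rewrite /total_dim (bigD1 l) // [ltnRHS](bigD1 l) //= -addSn leq_add //.
    by rewrite ltn_neqAle el dimvec_of_le.
  by apply: leq_sum => j _; apply: dimvec_of_le.
apply: (ispM); last by exists (qbinom_dim d (dimvec_of e)).
apply: (ispM); last by exists 'X^`|recursion_exp d (dimvec_of e)|; rewrite eval_intXn.
have isp1 : isp 1 by exists 1; rewrite -polyC1 eval_intC.
elim: (total_dim d - _)%N => [|m IHm]; first by rewrite expr0.
by rewrite exprS mulN1r; apply: (ispN).
Qed.

End Recursion.

Local Open Scope complex_scope.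

Theorem corollary3p1 (R : realType) (Q : quiver) :
  let L : K0 R[i] := Lefschetz R[i] in
  let N (d : dimvec Q) : K0 R[i] := K0_class (nullcone_variety R[i] d) in
  (forall d : dimvec Q, d <> [ffun=> 0%N] ->
     N d = - \sum_(e : subdim d | dimvec_of e != d)
       (-1) ^+ (total_dim d - total_dim (dimvec_of e))%N
       * L ^+ `|recursion_exp d (dimvec_of e)|%N
       * eval_int (qbinom_dim d (dimvec_of e)) L
       * N (dimvec_of e))
  /\ (forall d : dimvec Q, exists n : {poly int}, N d = eval_int n L).
Proof.
by split=> d; [apply: nullcone_recursion | apply: nullcone_polynomial].
Qed.
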